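(* Let $G$ be an abelian group, and let all homology groups be taken with coefficients in $G$. Let $X$ be a topological space, let $\mathscr{U}=\{U_i\}_{i\in\mathcal{I}}$ be an open cover of $X$, and let $N$ be the nerve of this cover. Fix an integer $k\in\mathbb{N}=\{0,1,2,\dots\}$. Suppose that $\widetilde H_j\left(\bigcap_{i\in\sigma}U_i\right)=0$ for every simplex $\sigma\in N^{(k)}$ (the $k$-skeleton of $N$) and every $j\in\{0,\dots,k-\dim\sigma\}$. Then: (1) $H_j(X)\cong H_j(N)$ for all $j\in\{0,\dots,k\}$; (2) if $H_{k+1}(N)\neq 0$, then $H_{k+1}(X)\neq 0$.
   Context: The nerve of a cover $\mathscr{U}=\{U_i\}_{i\in\mathcal{I}}$ of $X$ is the abstract simplicial complex on the index set $\mathcal{I}$ whose simplices are the nonempty finite subsets $\sigma\subset\mathcal{I}$ such that $\bigcap_{i\in\sigma}U_i$ is nonempty; $\dim\sigma=|\sigma|-1$. For a simplicial complex $K$, $K^{(n)}$ denotes its $n$-skeleton, i.e. the set of simplices of dimension at most $n$. Homology of topological spaces is singular homology, $\widetilde H_j$ denotes reduced singular homology, and $H_j(N)$ is the simplicial homology of $N$ (equivalently, the singular homology of its geometric realization). *)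

(* Defs.v *)
From HB Require Import structures.
From mathcomp Require Import all_boot all_order all_algebra finmap.
From mathcomp Require Import ring_quotient zify.
From mathcomp Require Import all_classical all_reals wochoice.
From mathcomp Require Import topology.

Set Implicit Arguments.
Unset Strict Implicit.
Unset Printing Implicit Defensive.

Import Order.TTheory GRing.Theory Num.Theory.
Import numFieldTopology.Exports.

Local Open Scope classical_set_scope.
Local Open Scope ring_scope.

(* Finitely supported functions T -> G, i.e. formal sums of elements of T with
   coefficients in G (the library's {freeg T / G} is an additive group only when
   G is a ring). *)
Section Chains.
Variables (T : choiceType) (G : zmodType).

Definition fin_supported : {pred T -> G} :=
  fun c => `[< finite_set [set s | c s != 0] >].

Lemma fin_supportedP (c : T -> G) :
  reflect (finite_set [set s | c s != 0]) (c \in fin_supported).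
Proof. exact: asboolP. Qed.

Lemma fin_supported_zmod_closed : zmod_closed fin_supported.
Proof.
split=> [|f g].
  apply/fin_supportedP; apply: (sub_finite_set _ (finite_set0 T)) => s /=.
  by rewrite eqxx.
move=> /fin_supportedP ff /fin_supportedP fg; apply/fin_supportedP.
have fu : finite_set ([set s | f s != 0] `|` [set s | g s != 0]).
  by rewrite finite_setU.
apply: (sub_finite_set _ fu) => s /= sfg.
apply: contrapT => /not_orP[/negP/negPn/eqP f0 /negP/negPn/eqP g0].
move: sfg; suff -> : (f - g) s = 0 by rewrite eqxx.
by rewrite [LHS](_ : _ = f s - g s)// f0 g0 subrr.
Qed.

HB.instance Definition _ := GRing.isZmodClosed.Build (T -> G) fin_supported
  fin_supported_zmod_closed.

Definition fchain := {c : T -> G | c \in fin_supported}.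
HB.instance Definition _ := SubChoice.on fchain.
HB.instance Definition _ := [SubChoice_isSubZmodule of fchain by <:].

Lemma fchain_finite (c : fchain) : finite_set [set s | val c s != 0].
Proof. exact/fin_supportedP/(valP c). Qed.

Lemma single_fin_supported (s : T) (g : G) :
  (fun t => if t == s then g else 0) \in fin_supported.
Proof.
apply/fin_supportedP; apply: (sub_finite_set _ (finite_set1 s)) => t /=.
by case: (t =P s) => //; rewrite eqxx.
Qed.

Definition single (s : T) (g : G) : fchain :=
  exist (fun c => c \in fin_supported) _ (single_fin_supported s g).

Lemma single_is_additive s : {morph single s : g h / g - h}.
Proof.
move=> g h; apply/val_inj/funext => t; rewrite /= [RHS](_ : _ =
  (if t == s then g else 0) - (if t == s then h else 0))//.
by case: ifP; rewrite ?subrr.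
Qed.

(* The additive map sending `single s g` to `F s g`, for F additive in g. *)
Definition linext (V : zmodType) (F : T -> G -> V) (c : fchain) : V :=
  \sum_(s \in [set: T]) F s (val c s).

Lemma linext_is_additive (V : zmodType) (F : T -> G -> V) :
  (forall s, {morph F s : g h / g - h}) -> {morph linext F : c d / c - d}.
Proof.
move=> Fadd c d.
have F0 s : F s 0 = 0 by rewrite -(subrr 0) Fadd subrr.
set D := [set s | val c s != 0] `|` [set s | val d s != 0].
have Dfin : finite_set D by rewrite finite_setU; split; exact: fchain_finite.
have out s : ~ D s -> val c s = 0 /\ val d s = 0.
  by move=> /not_orP[/negP/negPn/eqP ? /negP/negPn/eqP].
have restr e : (forall s, ~ D s -> val e s = 0) ->
    linext F e = \sum_(s <- fset_set D) F s (val e s).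
  move=> e0; rewrite /linext; apply: fsbigTE => s.
  by rewrite in_fset_set// => /negP; rewrite inE => /e0 ->.
have cd0 s : ~ D s -> val (c - d) s = 0.
  by move=> /out[cs ds]; rewrite [LHS](_ : _ = val c s - val d s)// cs ds subrr.
rewrite (restr _ cd0) (restr c); last by move=> s /out[].
rewrite (restr d); last by move=> s /out[].
by rewrite -sumrB; apply: eq_bigr => s _; rewrite -Fadd.
Qed.

End Chains.

(* Semi-simplicial sets: `face i` deletes the i-th vertex of an (n+1)-simplex. *)
Record deltaSet := DeltaSet {
  simplex : nat -> choiceType;
  face : forall n, 'I_n.+2 -> simplex n.+1 -> simplex n;
  faceK : forall n (i j : 'I_n.+2) (s : simplex n.+2), (i <= j)%N ->
    face i (face (lift ord0 j) s) = face j (face (lift ord_max i) s)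
}.

Section Homology.
Variables (S : deltaSet) (G : zmodType).

Definition bdry n : fchain (simplex S n.+1) G -> fchain (simplex S n) G :=
  linext (fun s g => \sum_(i < n.+2) single (face i s) (g *~ (-1) ^+ i)).

Lemma bdry_is_additive n : {morph @bdry n : c d / c - d}.
Proof.
apply: linext_is_additive => s g h; rewrite -sumrB; apply: eq_bigr => i _.
by rewrite mulrzBl single_is_additive.
Qed.

Definition augm : fchain (simplex S 0) G -> G := linext (fun=> id).

Lemma augm_is_additive : {morph augm : c d / c - d}.
Proof. exact: linext_is_additive. Qed.

Definition cycles (n : nat) : {pred fchain (simplex S n) G} :=
  match n with
  | 0%N => predT
  | m.+1 => fun c => bdry c == 0
  end.

(* Kernel of the differential of the augmented complex. *)
Definition rcycles (n : nat) : {pred fchain (simplex S n) G} :=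
  match n with
  | 0%N => fun c => augm c == 0
  | m.+1 => @cycles m.+1
  end.

Definition boundaries (n : nat) : {pred fchain (simplex S n) G} :=
  fun c => `[< exists b, bdry b = c >].

Lemma ker_zmod_closed (A B : zmodType) (f : A -> B) :
  {morph f : c d / c - d} -> zmod_closed (fun c => f c == 0).
Proof.
move=> fB; have f0 : f 0 = 0 by rewrite -(subrr 0) fB subrr.
split=> [|c d]; rewrite !unfold_in ?f0//.
by move=> /eqP fc /eqP fd; rewrite fB fc fd subrr.
Qed.

Lemma cycles_zmod_closed n : zmod_closed (@cycles n).
Proof. by case: n => [|n]; [|exact: ker_zmod_closed (@bdry_is_additive n)]. Qed.

Lemma rcycles_zmod_closed n : zmod_closed (@rcycles n).
Proof.
case: n => [|n]; first exact: ker_zmod_closed augm_is_additive.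
exact: cycles_zmod_closed.
Qed.

Lemma boundaries_zmod_closed n : zmod_closed (@boundaries n).
Proof.
split=> [|c d].
  by apply/asboolP; exists 0; rewrite -(subrr 0) bdry_is_additive subrr.
move=> /asboolP[b <-] /asboolP[e <-]; apply/asboolP; exists (b - e).
exact: bdry_is_additive.
Qed.

HB.instance Definition _ n :=
  GRing.isZmodClosed.Build _ (@cycles n) (cycles_zmod_closed n).
HB.instance Definition _ n :=
  GRing.isZmodClosed.Build _ (@rcycles n) (rcycles_zmod_closed n).
HB.instance Definition _ n :=
  GRing.isZmodClosed.Build _ (@boundaries n) (boundaries_zmod_closed n).

End Homology.

Section Subquotient.
Variables (A : zmodType) (Z B : zmodClosed A).

(* Z / (Z `&` B), that is, Z / B when B is contained in Z. *)
Definition subZ := {x : A | x \in Z}.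
HB.instance Definition _ := SubChoice.on subZ.
HB.instance Definition _ := [SubChoice_isSubZmodule of subZ by <:].

Definition subB : {pred subZ} := fun x => val x \in B.

Lemma subB_zmod_closed : zmod_closed subB.
Proof.
have inB x : (x \in subB) = (val x \in B) by [].
split=> [|x y]; rewrite !inB; first by rewrite raddf0 rpred0.
by rewrite raddfB; exact: rpredB.
Qed.
HB.instance Definition _ :=
  GRing.isZmodClosed.Build subZ subB subB_zmod_closed.

Definition subquotient : zmodType := Quotient.quot subB.
End Subquotient.

Definition homology (S : deltaSet) (G : zmodType) (n : nat) : zmodType :=
  subquotient (@cycles S G n) (@boundaries S G n).

Definition reduced_homology (S : deltaSet) (G : zmodType) (n : nat) : zmodType :=
  subquotient (@rcycles S G n) (@boundaries S G n).

Definition zmod_isomorphic (A B : zmodType) : Prop :=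
  exists f : {additive A -> B}, bijective f.

Section Singular.
Variable R : realType.

Definition stdsimplex (n : nat) : set 'rV[R]_n.+1 :=
  [set x | (forall i, 0 <= x 0 i) /\ \sum_i x 0 i = 1].

Definition coface_row n (i : 'I_n.+2) (x : 'rV[R]_n.+1) : 'rV[R]_n.+2 :=
  \row_j (if unlift i j is Some k then x 0 k else 0).

Lemma coface_row_stdsimplex n (i : 'I_n.+2) (x : set_type (@stdsimplex n)) :
  coface_row i (val x) \in @stdsimplex n.+1.
Proof.
have /set_mem[x0 x1] := valP x; apply/mem_set; split=> [j|].
  by rewrite mxE; case: unlift.
rewrite (bigD1_ord i)//= mxE unlift_none add0r -[RHS]x1.
by apply: eq_bigr => k _; rewrite mxE liftK.
Qed.

Definition coface n (i : 'I_n.+2) (x : set_type (@stdsimplex n)) :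
    set_type (@stdsimplex n.+1) :=
  exist (fun y => y \in @stdsimplex n.+1) _ (coface_row_stdsimplex i x).

Lemma continuous_coface n (i : 'I_n.+2) : continuous (@coface n i).
Proof.
apply: continuous_comp_initial => /= x.
apply: (@continuous_comp _ _ _ set_val (coface_row i)).
  exact: initial_continuous.
move=> A [P Pnbhs PA].
exists (fun _ k => P 0 (lift i k)) => [a k|y yP].
  by have := Pnbhs 0 (lift i k); rewrite mxE liftK (ord1 a).
apply: PA => a j; rewrite (ord1 a) mxE; case: unliftP => [k ->|ji].
  exact: yP.
have := Pnbhs 0 j; rewrite mxE ji unlift_none; exact: nbhs_singleton.
Qed.

HB.instance Definition _ n i :=
  isContinuous.Build _ _ (@coface n i) (@continuous_coface n i).

Lemma cofaceK n (i j : 'I_n.+2) x : (i <= j)%N ->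
  coface (lift ord0 j) (coface i x) = coface (lift ord_max i) (coface j x).
Proof.
move=> ij; apply/val_inj/rowP => t; rewrite !mxE.
case: (unliftP (lift ord0 j) t) => [u ->|->].
  rewrite mxE; case: (unliftP i u) => [v ->|->].
    have -> : lift (lift ord0 j) (lift i v) = lift (lift ord_max i) (lift j v).
      apply: val_inj => /=; rewrite /bump/=.
      have := ltn_ord i; have := ltn_ord v; lia.
    by rewrite liftK mxE liftK.
  have -> : lift (lift ord0 j) i = lift ord_max i.
    apply: val_inj => /=; rewrite /bump/=; have := ltn_ord i; lia.
  by rewrite unlift_none.
have -> : lift ord0 j = lift (lift ord_max i) j.
  apply: val_inj => /=; rewrite /bump/=; have := ltn_ord i; lia.
by rewrite liftK mxE unlift_none.
Qed.

Definition singular_face (X : topologicalType) n (i : 'I_n.+2)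
    (s : continuousType (set_type (@stdsimplex n.+1)) X) :
    continuousType (set_type (@stdsimplex n)) X :=
  s \o coface i.

Lemma singular_faceK (X : topologicalType) n (i j : 'I_n.+2)
    (s : continuousType (set_type (@stdsimplex n.+2)) X) : (i <= j)%N ->
  singular_face i (singular_face (lift ord0 j) s) =
  singular_face j (singular_face (lift ord_max i) s).
Proof. by move=> ij; apply/continuousEP => x /=; rewrite cofaceK. Qed.

Definition singular (X : topologicalType) : deltaSet :=
  DeltaSet (@singular_faceK X).

End Singular.

(* R is any model of the real numbers, used only to build the standard simplices. *)
Definition singular_homology (R : realType) (G : zmodType) (X : topologicalType)
    (n : nat) : zmodType :=
  homology (singular R X) G n.

Definition reduced_singular_homology (R : realType) (G : zmodType)
    (X : topologicalType) (n : nat) : zmodType :=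
  reduced_homology (singular R X) G n.

Definition del (T : Type) (i : nat) (s : seq T) := take i s ++ drop i.+1 s.

Lemma size_del (T : Type) i (s : seq T) : (i < size s)%N ->
  size (del i s) = (size s).-1.
Proof. by move=> i_s; rewrite size_cat size_take i_s size_drop; lia. Qed.

Lemma nth_del (T : Type) (x0 : T) i s k : nth x0 (del i s) k = nth x0 s (bump i k).
Proof.
rewrite nth_cat size_take /bump; case: (ltnP i (size s)) => i_s.
  case: (ltnP k i) => ki; rewrite ?nth_take ?nth_drop//.
  by congr nth; lia.
case: (ltnP k (size s)) => ks.
  rewrite nth_take; last exact: leq_trans i_s.
  by rewrite leqNgt (leq_trans ks i_s).
by rewrite nth_drop !nth_default//; lia.
Qed.

Lemma delC (T : Type) i j (s : seq T) : (i <= j)%N -> (j.+1 < size s)%N ->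
  del i (del j.+1 s) = del j (del i s).
Proof.
case: s => // x0 s' ij; set s := x0 :: s' => js.
have szi : size (del i s) = (size s).-1 by apply: size_del; lia.
have szj : size (del j.+1 s) = (size s).-1 by apply: size_del; lia.
apply: (@eq_from_nth _ x0) => [|k _]; first by rewrite !size_del; lia.
by rewrite !nth_del /bump; congr nth; lia.
Qed.

Lemma del_subseq (T : eqType) i (s : seq T) : subseq (del i s) s.
Proof.
rewrite -{2}(cat_take_drop i s) cat_subseq// -addn1 addnC -drop_drop.
exact: drop_subseq.
Qed.

(* Abstract simplicial complexes with vertices in I (not every element of I need
   be a vertex). *)
Record scomplex (I : choiceType) := SComplex {
  simplices :> {fset I} -> Prop;
  simplices_neq0 : forall s, simplices s -> s != fset0;
  simplices_sub : forall s t, simplices s -> t != fset0 -> (t `<=` s)%fset ->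
    simplices t
}.

Definition sdim (I : choiceType) (s : {fset I}) : nat := #|` s|.-1.

Definition skeleton (I : choiceType) (n : nat) (K : scomplex I) : set {fset I} :=
  [set s | K s /\ (sdim s <= n)%N].

(* The vertices are ordered by a fixed well-ordering of I; another choice of
   ordering changes the homology groups only up to isomorphism. *)
Definition vle (I : choiceType) : rel I := sval (well_ordering_principle I).

Lemma vle_wo_chain (I : choiceType) : wo_chain (@vle I) predT.
Proof. by move=> A _; exact: (svalP (well_ordering_principle I)). Qed.

Lemma vle_total (I : choiceType) : total (@vle I).
Proof. by move=> x y; apply: (wo_chainW (@vle_wo_chain I)). Qed.

Lemma vle_anti (I : choiceType) : antisymmetric (@vle I).
Proof. by move=> x y; apply: (wo_chain_antisymmetric (@vle_wo_chain I)). Qed.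

Lemma vle_trans (I : choiceType) : transitive (@vle I).
Proof.
move=> y x z xy yz.
have [|m [[mA mmin] _]] :=
  svalP (well_ordering_principle I) (mem [:: x; y; z]).
  by exists x; exact: mem_head.
move: mA; rewrite !inE => /or3P[] /eqP mE.
- by rewrite -mE; apply: mmin; rewrite !inE eqxx !orbT.
- have yx : vle y x by rewrite -mE; apply: mmin; rewrite !inE eqxx.
  by have -> : x = y by apply: vle_anti; rewrite xy yx.
- have zy : vle z y by rewrite -mE; apply: mmin; rewrite !inE eqxx !orbT.
  by have <- : y = z by apply: vle_anti; rewrite yz zy.
Qed.

Section Simplicial.
Variables (I : choiceType) (K : scomplex I).

Definition vertices (s : {fset I}) : seq I := sort (@vle I) (enum_fset s).

Definition nsimplex (n : nat) : choiceType :=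
  set_type [set s | K s /\ #|` s| = n.+1].

Definition del_vertex (i : nat) (s : {fset I}) : {fset I} :=
  [fset x in del i (vertices s)]%fset.

Lemma in_del_vertex i s x : (x \in del_vertex i s) = (x \in del i (vertices s)).
Proof. by rewrite /del_vertex; move: (del i _) => l; rewrite !inE. Qed.

Lemma size_vertices s : size (vertices s) = #|` s|.
Proof. by rewrite size_sort. Qed.

Lemma vertices_uniq s : uniq (vertices s).
Proof. by rewrite sort_uniq fset_uniq. Qed.

Lemma vertices_fset (l : seq I) : sorted (@vle I) l -> uniq l ->
  vertices [fset x in l]%fset = l.
Proof.
move=> sl ul; apply: (sorted_eq (@vle_trans I) (@vle_anti I)) => //.
  exact/sort_sorted/vle_total.
rewrite perm_sort; apply: uniq_perm => //.
by move=> x; rewrite !inE.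
Qed.

Lemma vertices_del i s : vertices (del_vertex i s) = del i (vertices s).
Proof.
apply: vertices_fset.
  apply: (subseq_sorted (@vle_trans I) (del_subseq _ _)).
  exact/sort_sorted/vle_total.
exact: (subseq_uniq (del_subseq _ _) (vertices_uniq s)).
Qed.

Lemma card_del_vertex i s : (i < #|` s|)%N -> #|` del_vertex i s| = #|` s|.-1.
Proof.
by move=> i_s; rewrite -!size_vertices vertices_del size_del// size_vertices.
Qed.

Lemma del_vertexP n (i : 'I_n.+2) (s : nsimplex n.+1) :
  del_vertex i (val s) \in [set s | K s /\ #|` s| = n.+1].
Proof.
have /set_mem[Ks sn] := valP s; apply/mem_set.
have cs : #|` del_vertex i (val s)| = n.+1 by rewrite card_del_vertex sn.
split=> //; apply: (simplices_sub Ks); first by rewrite -cardfs_eq0 cs.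
apply/fsubsetP => x; rewrite in_del_vertex => xs.
by have := mem_subseq (del_subseq _ _) xs; rewrite mem_sort.
Qed.

Definition simplicial_face n (i : 'I_n.+2) (s : nsimplex n.+1) : nsimplex n :=
  exist (fun t => t \in [set s | K s /\ #|` s| = n.+1]) _ (del_vertexP i s).

Lemma simplicial_faceK n (i j : 'I_n.+2) (s : nsimplex n.+2) : (i <= j)%N ->
  simplicial_face i (simplicial_face (lift ord0 j) s) =
  simplicial_face j (simplicial_face (lift ord_max i) s).
Proof.
move=> ij; have /set_mem[_ sn] := valP s.
apply: val_inj => /=; rewrite /del_vertex !vertices_del.
have -> : bump n.+2 i = i by rewrite /bump leqNgt ltn_ord.
rewrite [bump 0 j]/bump add1n delC//.
by rewrite size_vertices sn ltnS ltn_ord.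
Qed.

Definition simplicial : deltaSet := DeltaSet simplicial_faceK.

End Simplicial.

Definition simplicial_homology (G : zmodType) (I : choiceType) (K : scomplex I)
    (n : nat) : zmodType :=
  homology (simplicial K) G n.

Section Nerve.
Variables (X : Type) (I : choiceType) (U : I -> set X).

Definition cover_meet (s : {fset I}) : set X := \bigcap_(i in [set` s]) U i.

Lemma nerve_neq0 s : s != fset0 /\ cover_meet s !=set0 -> s != fset0.
Proof. by case. Qed.

Lemma nerve_sub s t : s != fset0 /\ cover_meet s !=set0 ->
  t != fset0 -> (t `<=` s)%fset -> t != fset0 /\ cover_meet t !=set0.
Proof.
move=> [_ [x sx]] t0 /fsubsetP ts; split=> //; exists x => i /= it.
by apply: sx; exact: ts.
Qed.

Definition nerve : scomplex I := SComplex nerve_neq0 nerve_sub.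

End Nerve.

(* Main.v *)
Require Import Defs.
From HB Require Import structures.
From mathcomp Require Import all_boot all_order all_algebra finmap.
From mathcomp Require Import ring_quotient zify lra.
From mathcomp Require Import all_classical all_reals wochoice topology.
From mathcomp Require Import normedtype sequences.

(* Singular chains of X can be replaced by U-small ones: iterated barycentric
   subdivision is chain homotopic to the identity, and it makes every simplex small
   by Lebesgue's number lemma.

   Small chains are then compared with the chains of the nerve N through the double
   complex C_p(N; S_q(X)), restricted to the elements whose coefficient at a simplex
   s is carried by the intersection of the U_i, i in s.  Its rows, augmented to the
   small chains, are exact: for a fixed singular simplex t they compute the homology
   of the full simplex on { i | t lies in U_i }, contracted onto its least vertex.
   Its columns, augmented to C_p(N; G), are exact in total degree at most k by
   hypothesis, and the augmentation is always onto.  Walking along staircases of the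
   double complex relates the cycles of X to those of N: this is a bijection between
   homology classes in degrees at most k and, in degree k + 1, a map from H(X) onto
   H(N).

   Only acyclicity with coefficients in G is available, so there need not be a chain
   map from C(N; G) to S(X; G); hence the element-wise staircases. *)

Set Implicit Arguments.
Unset Strict Implicit.
Unset Printing Implicit Defensive.

Import Order.TTheory GRing.Theory Num.Theory.
Import numFieldNormedType.Exports.
Local Open Scope classical_set_scope.
Local Open Scope ring_scope.

(** * Formal sums and chain complexes of semi-simplicial sets *)

HB.instance Definition _ (T : choiceType) (G : zmodType) (s : T) :=
  GRing.isZmodMorphism.Build G (fchain T G) (single s) (single_is_additive s).

Section FormalSums.
Variables (T : choiceType) (G : zmodType).
Implicit Types (c d : fchain T G) (P : set T).

Definition coeff c : T -> G := val c.

Lemma coeff_finite c : finite_set [set s | coeff c s != 0].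
Proof. exact: fchain_finite. Qed.

Lemma coeffD c d s : coeff (c + d) s = coeff c s + coeff d s.
Proof. by []. Qed.

Lemma coeffB c d s : coeff (c - d) s = coeff c s - coeff d s.
Proof. by []. Qed.

Lemma coeff0 s : coeff (0 : fchain T G) s = 0.
Proof. by []. Qed.

Lemma coeff_sum (J : Type) (r : seq J) (F : J -> fchain T G) s :
  coeff (\sum_(i <- r) F i) s = \sum_(i <- r) coeff (F i) s.
Proof. by elim/big_rec2: _ => // i x y _ <-. Qed.

Lemma fchain_eq c d : (forall s, coeff c s = coeff d s) -> c = d.
Proof. by move=> cd; apply/val_inj/funext. Qed.

Lemma coeff_single (s t : T) (g : G) :
  coeff (single s g) t = if t == s then g else 0.
Proof. by []. Qed.

Lemma fchain_sum_seq (r : seq T) c : uniq r ->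
  (forall s, coeff c s != 0 -> s \in r) -> c = \sum_(s <- r) single s (coeff c s).
Proof.
move=> ur rP; apply: fchain_eq => t; rewrite coeff_sum.
have [tc|/rP tr] := eqVneq (coeff c t) 0.
  by rewrite big1 // => s _; rewrite coeff_single; case: eqP => // <-.
rewrite (bigD1_seq t) //= coeff_single eqxx big1 ?addr0 // => s /negPf st.
by rewrite coeff_single eq_sym st.
Qed.

Lemma fchain_sum_single c :
  c = \sum_(s <- fset_set [set s | coeff c s != 0]) single s (coeff c s).
Proof.
apply: fchain_sum_seq; first exact: fset_uniq.
by move=> s cs; rewrite in_fset_set ?inE //; exact: coeff_finite.
Qed.

Lemma fchain_neq0 c : c != 0 -> exists s, coeff c s != 0.
Proof.
move=> c0; apply: contrapT => /forallNP cN; move/eqP: c0; apply.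
by apply: fchain_eq => s; have /negP/negPn/eqP -> := cN s.
Qed.

Definition supp_in P c := forall s, coeff c s != 0 -> P s.

Lemma supp_in0 P : supp_in P 0.
Proof. by move=> s; rewrite coeff0 eqxx. Qed.

Lemma supp_inB P c d : supp_in P c -> supp_in P d -> supp_in P (c - d).
Proof.
move=> Pc Pd s; rewrite coeffB.
by have [c0|/Pc//] := eqVneq (coeff c s) 0; rewrite c0 sub0r oppr_eq0 => /Pd.
Qed.

Lemma supp_inD P c d : supp_in P c -> supp_in P d -> supp_in P (c + d).
Proof.
move=> Pc Pd; rewrite -[d]opprK -[- d]sub0r; apply: supp_inB => //.
by apply: supp_inB => //; exact: supp_in0.
Qed.

Lemma supp_inN P c : supp_in P c -> supp_in P (- c).
Proof. by rewrite -sub0r; apply: supp_inB; exact: supp_in0. Qed.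

Lemma supp_in_Mz P c z : supp_in P c -> supp_in P (c *~ z).
Proof.
move=> cP; have cPn n : supp_in P (c *+ n).
  by elim: n => [|n IH]; rewrite ?mulrS; [exact: supp_in0|exact: supp_inD].
by case: z => n; [exact: cPn|apply: supp_inN; exact: cPn].
Qed.

Lemma supp_in_sum P (J : eqType) (r : seq J) (F : J -> fchain T G) :
  (forall i, i \in r -> supp_in P (F i)) -> supp_in P (\sum_(i <- r) F i).
Proof.
elim: r => [|i r IH] PF; first by rewrite big_nil; exact: supp_in0.
rewrite big_cons; apply: supp_inD; first exact/PF/mem_head.
by apply: IH => j jr; apply: PF; rewrite inE jr orbT.
Qed.

Lemma supp_in_single P s g : P s -> supp_in P (single s g).
Proof. by move=> Ps t; rewrite coeff_single; case: (t =P s) => [->|_ /eqP]. Qed.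

Lemma supp_inT c : supp_in setT c.
Proof. by []. Qed.

Lemma sub_supp_in P Q c : P `<=` Q -> supp_in P c -> supp_in Q c.
Proof. by move=> PQ Pc s /Pc /PQ. Qed.

Lemma supp_in_ind P (Q : fchain T G -> Prop) :
  Q 0 -> (forall c d, Q c -> Q d -> Q (c + d)) ->
  (forall s g, P s -> Q (single s g)) -> forall c, supp_in P c -> Q c.
Proof.
move=> Q0 QD Q1 c Pc; rewrite (fchain_sum_single c) big_seq.
elim/big_ind: _ => // s; rewrite in_fset_set ?inE; last exact: coeff_finite.
by move=> /= cs; apply/Q1/Pc.
Qed.

Variable V : zmodType.

(** Bundling each [F s] as an additive map makes [lin F] additive with no side condition, so every
    map defined through [lin] gets its additive structure from the same lemma. *)
Definition lin (F : T -> {additive G -> V}) (c : fchain T G) : V :=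
  linext (fun s => F s : G -> V) c.

Lemma lin_is_zmod_morphism F : zmod_morphism (lin F).
Proof. by apply: linext_is_additive => s; exact: raddfB. Qed.

HB.instance Definition _ F :=
  GRing.isZmodMorphism.Build (fchain T G) V (lin F) (@lin_is_zmod_morphism F).

Lemma linextE (F : T -> G -> V) c :
  linext F c = \sum_(s \in [set: T]) F s (coeff c s).
Proof. by []. Qed.

Lemma linext_single (F : T -> G -> V) s g :
  (forall t, F t 0 = 0) -> linext F (single s g) = F s g.
Proof.
move=> F0; rewrite linextE (fsbigTE [fset s]%fset) => [|t]; last first.
  by rewrite coeff_single inE; case: eqP.
by rewrite big_seq_fset1 coeff_single eqxx.
Qed.

Lemma lin_single F s g : lin F (single s g) = F s g.
Proof. by rewrite /lin linext_single // => t; exact: raddf0. Qed.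

Lemma supp_in_additive_ext P (f h : {additive fchain T G -> V}) :
  (forall s g, P s -> f (single s g) = h (single s g)) ->
  forall c, supp_in P c -> f c = h c.
Proof.
move=> fh; apply: supp_in_ind => // [|c d]; first by rewrite !raddf0.
by rewrite !raddfD => -> ->.
Qed.

Lemma additive_ext (f h : {additive fchain T G -> V}) :
  (forall s g, f (single s g) = h (single s g)) -> f =1 h.
Proof. by move=> fh c; apply: (@supp_in_additive_ext setT). Qed.

End FormalSums.
Arguments lin {T G V}.

Lemma supp_in_additive (T T' : choiceType) (G G' : zmodType) (P : set T)
    (Q : set T') (f : {additive fchain T G -> fchain T' G'}) :
  (forall s g, P s -> supp_in Q (f (single s g))) ->
  forall c, supp_in P c -> supp_in Q (f c).
Proof.
move=> fPQ; apply: supp_in_ind => // [|c d Qc Qd].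
  by rewrite raddf0; exact: supp_in0.
by rewrite raddfD; exact: supp_inD.
Qed.

Section Coefficients.
Variables (T : choiceType) (V W : zmodType) (phi : {additive V -> W}).

Lemma coef_fin_supported (c : fchain T V) :
  (fun t => phi (coeff c t)) \in @fin_supported T W.
Proof.
apply/fin_supportedP; apply: sub_finite_set (coeff_finite c) => t /=.
by apply: contra_neq => ->; rewrite raddf0.
Qed.

(** Change of coefficients along [phi]. Since [V] may itself be a chain group, [coef] of [bdry] and
    of [augm] will be the vertical differential of the double complex and its augmentation to the
    chains of the nerve. *)
Definition coef (c : fchain T V) : fchain T W :=
  exist (fun c => c \in @fin_supported T W) _ (coef_fin_supported c).

Lemma coeff_coef c t : coeff (coef c) t = phi (coeff c t).
Proof. by []. Qed.

Lemma coef_is_zmod_morphism : zmod_morphism coef.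
Proof. by move=> c d; apply: fchain_eq => t; rewrite coeff_coef !coeffB raddfB. Qed.

HB.instance Definition _ :=
  GRing.isZmodMorphism.Build (fchain T V) (fchain T W) coef coef_is_zmod_morphism.

Lemma coef_single t v : coef (single t v) = single t (phi v).
Proof.
apply: fchain_eq => s; rewrite coeff_coef !coeff_single.
by case: eqP => // _; rewrite raddf0.
Qed.

End Coefficients.

HB.instance Definition _ (S : deltaSet) (G : zmodType) n :=
  GRing.isZmodMorphism.Build _ _ (@bdry S G n) (@bdry_is_additive S G n).
HB.instance Definition _ (S : deltaSet) (G : zmodType) :=
  GRing.isZmodMorphism.Build _ _ (@augm S G) (@augm_is_additive S G).

Section Boundary.
Variables (S : deltaSet) (G : zmodType).

Lemma bdry_single n (s : simplex S n.+1) (g : G) :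
  bdry (single s g) = \sum_(i < n.+2) single (face i s) (g *~ (-1) ^+ i).
Proof.
rewrite /bdry linext_single // => t.
by apply: big1 => i _; rewrite mul0rz raddf0.
Qed.

Lemma augm_single (s : simplex S 0) (g : G) : augm (single s g) = g.
Proof. by rewrite /augm linext_single. Qed.

Lemma bdry_bdry n (c : fchain (simplex S n.+2) G) : bdry (bdry c) = 0.
Proof.
move: c; apply: (@additive_ext _ _ _ (@bdry S G n \o @bdry S G n.+1) \0) => s g /=.
rewrite bdry_single raddf_sum /=.
under eq_bigr do rewrite bdry_single.
pose f (i : 'I_n.+2) (j : 'I_n.+3) :=
  single (face i (face j s)) (g *~ (-1) ^+ (i + j)).
have fE i j : single (face i (face j s)) (g *~ (-1) ^+ j *~ (-1) ^+ i) = f i j.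
  by rewrite -mulrzA -exprD addnC.
under eq_bigr do under eq_bigr do rewrite fE.
rewrite exchange_big /=.
under eq_bigr => i _.
  rewrite (bigID (fun j : 'I_n.+3 => (i < j)%N)) /=.
  under [X in _ + X]eq_bigl do rewrite -leqNgt.
  over.
rewrite big_split /=.
(* In the half [i < j] the index [j] drops by one, in the half [j <= i] it keeps its value. After an
   exchange of sums both halves run over the same pairs, and [faceK] cancels them two by two. *)
have -> : \sum_(i < n.+2) \sum_(j < n.+3 | (i < j)%N) f i j =
   \sum_(i < n.+2) \sum_(j < n.+2 | (i <= j)%N) f i (lift ord0 j).
  apply: eq_bigr => i _; rewrite big_mkcond big_ord_recl /= add0r.
  by rewrite -big_mkcond.
have -> : \sum_(i < n.+2) \sum_(j < n.+3 | (j <= i)%N) f i j =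
   \sum_(i < n.+2) \sum_(j < n.+2 | (j <= i)%N) f i (lift ord_max j).
  apply: eq_bigr => i _; rewrite big_mkcond (bigD1_ord ord_max) //=.
  rewrite leqNgt (ltn_ord i) add0r [RHS]big_mkcond /=.
  apply: eq_bigr => j _.
  have -> // : bump n.+2 j = j by rewrite /bump leqNgt ltn_ord.
rewrite [X in _ + X](exchange_big_dep predT) //= -big_split big1 //= => i _.
rewrite -big_split big1 //= => j ij.
have -> : f i (lift ord0 j) = - f j (lift ord_max i); last by rewrite addNr.
rewrite /f faceK // -raddfN /=; congr (single _ _).
have -> : bump n.+2 i = i by rewrite /bump leqNgt ltn_ord.
by rewrite /bump /= add1n addnS exprS mulN1r mulrNz addnC.
Qed.

Lemma augm_bdry (c : fchain (simplex S 1) G) : augm (bdry c) = 0.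
Proof.
move: c; apply: (@additive_ext _ _ _ (@augm S G \o @bdry S G 0) \0) => s g /=.
rewrite bdry_single raddf_sum /= !big_ord_recl big_ord0 /= !augm_single addr0.
by rewrite /bump /= expr0 expr1 mulrNz subrr.
Qed.

End Boundary.

Section BoundaryCoefficients.
Variables (S : deltaSet) (G H : zmodType) (phi : {additive G -> H}).

Lemma coef_bdry n (c : fchain (simplex S n.+1) G) :
  coef phi (bdry c) = bdry (coef phi c).
Proof.
move: c; apply: (@additive_ext _ _ _ (coef phi \o @bdry S G n)
  (@bdry S H n \o coef phi)) => s g /=.
rewrite coef_single !bdry_single raddf_sum /=.
by apply: eq_bigr => i _; rewrite coef_single raddfMz.
Qed.

Lemma augm_coef (c : fchain (simplex S 0) G) :
  augm (coef phi c) = phi (augm c).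
Proof.
move: c; apply: (@additive_ext _ _ _ (@augm S H \o coef phi)
  (phi \o @augm S G)) => s g /=.
by rewrite coef_single !augm_single.
Qed.

End BoundaryCoefficients.

(** * Subdivision of ordered chains *)

(* Ordered simplices as lists of points; the empty list makes this the augmented
   complex, so that [sbdry_cone] holds in every degree. *)
Section OrderedChains.
Variables (P : choiceType) (G : zmodType).
Local Notation C := (fchain (seq P) G).

Definition cone (p : P) : C -> C := lin (fun l => single (p :: l)).

HB.instance Definition _ p := GRing.isZmodMorphism.Build C C (cone p)
  (@lin_is_zmod_morphism _ _ _ (fun l => single (p :: l))).

Definition sbdry_simplex (l : seq P) (g : G) : C :=
  \sum_(i < size l) single (del i l) (g *~ (-1) ^+ i).

Lemma sbdry_simplex_is_zmod_morphism l : zmod_morphism (sbdry_simplex l).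
Proof.
move=> g h; rewrite /sbdry_simplex -sumrB; apply: eq_bigr => i _.
by rewrite mulrzBl raddfB.
Qed.

HB.instance Definition _ l := GRing.isZmodMorphism.Build G C (sbdry_simplex l)
  (@sbdry_simplex_is_zmod_morphism l).

Definition sbdry : C -> C := lin sbdry_simplex.

HB.instance Definition _ := GRing.isZmodMorphism.Build C C sbdry
  (@lin_is_zmod_morphism _ _ _ sbdry_simplex).

Lemma cone_single p l g : cone p (single l g) = single (p :: l) g.
Proof. by rewrite /cone lin_single. Qed.

Lemma sbdry_single l g :
  sbdry (single l g) = \sum_(i < size l) single (del i l) (g *~ (-1) ^+ i).
Proof. by rewrite /sbdry lin_single. Qed.

(** Deleting the new first vertex gives back [c]; deleting a later one commutes with coning and
    shifts the index by one, hence the minus sign. *)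
Lemma sbdry_cone p c : sbdry (cone p c) = c - cone p (sbdry c).
Proof.
move: c; apply: (@additive_ext _ _ _ (sbdry \o cone p)
  (idfun \- (cone p \o sbdry))) => l g /=.
rewrite cone_single !sbdry_single /= big_ord_recl /= expr0 mulr1z.
congr (_ + _); first by congr (single _ _); rewrite /del /= drop0.
rewrite (raddf_sum (cone p)) -sumrN; apply: eq_bigr => i _.
rewrite /= cone_single -[RHS]raddfN /=; congr (single _ _).
by rewrite /bump /= exprS mulN1r mulrNz.
Qed.

(** A nonempty list is a cone, so [sbdry_cone] reduces the claim to a shorter list. *)
Lemma sbdry_sbdry c : sbdry (sbdry c) = 0.
Proof.
move: c; apply: (@additive_ext _ _ _ (sbdry \o sbdry) \0) => l g /=.
elim: l => [|p l IH]; first by rewrite sbdry_single big_ord0 raddf0.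
by rewrite -cone_single sbdry_cone raddfB /= sbdry_cone IH raddf0 subr0 subrr.
Qed.

Variable apex : seq P -> P.

(* The fuel n stands for the length of the lists; the identities sbdry_sd and
   sbdry_sdh hold on all lists, whatever their length. *)
Fixpoint sd (n : nat) : {additive C -> C} :=
  if n is m.+1 then lin (fun l => cone (apex l) \o sd m \o sbdry \o single l)
  else idfun.

Fixpoint sdh (n : nat) : {additive C -> C} :=
  if n is m.+1 then
    lin (fun l => cone (apex l) \o (idfun \- (sdh m \o sbdry)) \o single l)
  else \0.

Lemma sd0 c : sd 0 c = c.
Proof. by []. Qed.

Lemma sdh0 c : sdh 0 c = 0.
Proof. by []. Qed.

Lemma sd_single n l g :
  sd n.+1 (single l g) = cone (apex l) (sd n (sbdry (single l g))).
Proof. by rewrite /= lin_single. Qed.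

Lemma sdh_single n l g : sdh n.+1 (single l g) =
  cone (apex l) (single l g - sdh n (sbdry (single l g))).
Proof. by rewrite /= lin_single. Qed.

Arguments sd : simpl never.
Arguments sdh : simpl never.

(** Write d for [sbdry]. By [sbdry_cone] the cone on sd(d l) has boundary sd(d l) minus a cone on
    d(sd(d l)), which by induction is sd(d(d l)) = 0. *)
Lemma sbdry_sd n c : sbdry (sd n.+1 c) = sd n (sbdry c).
Proof.
elim: n c => [|n IH] c; set m := (m in sd m (sbdry c)).
  apply: (@additive_ext _ _ _ (sbdry \o sd m.+1) (sd m \o sbdry)) => l g.
  change (sbdry (sd m.+1 (single l g)) = sd m (sbdry (single l g))).
  by rewrite sd_single sbdry_cone /= sbdry_sbdry raddf0 subr0.
apply: (@additive_ext _ _ _ (sbdry \o sd m.+1) (sd m \o sbdry)) => l g.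
change (sbdry (sd m.+1 (single l g)) = sd m (sbdry (single l g))).
rewrite sd_single sbdry_cone /m IH sbdry_sbdry.
by rewrite (raddf0 (sd n)) (raddf0 (cone (apex l))) subr0.
Qed.

(** Write d for [sbdry] and h for [sdh]. By induction d(h(d l)) = d l - sd(d l), so the cone on l -
    h(d l) has boundary l - h(d l) minus the cone on sd(d l), and that last cone is sd l. *)
Lemma sbdry_sdh n c :
  sbdry (sdh n.+1 c) + sdh n (sbdry c) = c - sd n.+1 c.
Proof.
suff E l g : sbdry (sdh n.+1 (single l g)) + sdh n (sbdry (single l g)) =
    single l g - sd n.+1 (single l g).
  exact: (@additive_ext _ _ _ ((sbdry \o sdh n.+1) \+ (sdh n \o sbdry))
     (idfun \- sd n.+1) E c).
elim: n c l g => [|n IH] c l g; rewrite sdh_single sbdry_cone sd_single.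
  by rewrite !sdh0 sd0 !subr0 addr0.
have {}IH d : sbdry (sdh n.+1 d) + sdh n (sbdry d) = d - sd n.+1 d.
  exact: (@additive_ext _ _ _ ((sbdry \o sdh n.+1) \+ (sdh n \o sbdry))
     (idfun \- sd n.+1) (IH 0) d).
have := IH (sbdry (single l g)).
rewrite sbdry_sbdry (raddf0 (sdh n)) addr0 (raddfB sbdry) /= => ->.
by rewrite subKr addrAC subrK.
Qed.

Definition all_in (Q : set P) (l : seq P) := forall p, p \in l -> Q p.

Lemma del_all_in Q l i : all_in Q l -> all_in Q (del i l).
Proof. by move=> Ql p pl; apply/Ql/(mem_subseq (del_subseq i l)). Qed.

Lemma supp_in_sbdry_single (Q : set (seq P)) l g :
  (forall i, (i < size l)%N -> Q (del i l)) -> supp_in Q (sbdry (single l g)).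
Proof.
move=> Ql; rewrite sbdry_single; apply: supp_in_sum => i _.
by apply: supp_in_single; exact: Ql.
Qed.

Lemma supp_in_cone (Q Q' : set (seq P)) p c :
  (forall l, Q l -> Q' (p :: l)) -> supp_in Q c -> supp_in Q' (cone p c).
Proof.
move=> QQ'; apply: supp_in_additive => l g Ql.
by rewrite /= cone_single; apply: supp_in_single; exact: QQ'.
Qed.

Definition has_size n : set (seq P) := [set l | size l = n].

Lemma supp_in_sbdry n c :
  supp_in (has_size n.+1) c -> supp_in (has_size n) (sbdry c).
Proof.
apply: supp_in_additive => l g ln; apply: supp_in_sbdry_single => i il.
by rewrite /has_size /= size_del // ln.
Qed.

Lemma supp_in_sd n c : supp_in (has_size n) c -> supp_in (has_size n) (sd n c).
Proof.
elim: n c => [|n IH] c //; apply: (supp_in_additive (f := sd n.+1)) => l g ln.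
rewrite sd_single.
apply: (@supp_in_cone (has_size n)) => [l' <- //|].
by apply: IH; apply: supp_in_sbdry; exact: supp_in_single.
Qed.

Lemma supp_in_sdh n c :
  supp_in (has_size n) c -> supp_in (has_size n.+1) (sdh n c).
Proof.
elim: n c => [|n IH] c; first by move=> _; exact: supp_in0.
apply: (supp_in_additive (f := sdh n.+1)) => l g ln; rewrite sdh_single.
apply: (@supp_in_cone (has_size n.+1)) => [l' <- //|].
apply: supp_inB; first exact: supp_in_single.
by apply: IH; apply: supp_in_sbdry; exact: supp_in_single.
Qed.

End OrderedChains.
Arguments cone {P G}.
Arguments sbdry {P G}.
Arguments sd {P G} apex n : simpl never.
Arguments sdh {P G} apex n : simpl never.

(** * Naturality of subdivision under maps of points *)

Section OrderedChainMaps.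
Variables (P P' : choiceType) (G : zmodType) (f : P -> P').
Local Notation C := (fchain (seq P) G).
Local Notation C' := (fchain (seq P') G).

Definition lmap : C -> C' := lin (fun l => single (map f l)).

HB.instance Definition _ := GRing.isZmodMorphism.Build C C' lmap
  (@lin_is_zmod_morphism _ _ _ (fun l => single (map f l))).

Lemma lmap_single l g : lmap (single l g) = single (map f l) g.
Proof. by rewrite /lmap lin_single. Qed.

Lemma map_del i l : map f (del i l) = del i (map f l).
Proof. by rewrite /del map_cat map_take map_drop. Qed.

Lemma lmap_sbdry c : lmap (sbdry c) = sbdry (lmap c).
Proof.
move: c; apply: (@additive_ext _ _ _ (lmap \o _) (_ \o lmap)) => l g /=.
rewrite lmap_single !sbdry_single raddf_sum size_map /=.
by apply: eq_bigr => i _; rewrite lmap_single map_del.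
Qed.

Lemma lmap_cone p c : lmap (cone p c) = cone (f p) (lmap c).
Proof.
move: c; apply: (@additive_ext _ _ _ (lmap \o _) (_ \o lmap)) => l g /=.
by rewrite !(cone_single, lmap_single).
Qed.

Variables (apex : seq P -> P) (apex' : seq P' -> P').
Hypothesis f_apex : forall l, (0 < size l)%N -> f (apex l) = apex' (map f l).

(** Naturality passes through every cone because [f] respects apexes. Requiring length exactly [n]
    keeps the recursion on nonempty lists, where [f_apex] applies. *)
Lemma lmap_sd n c :
  supp_in (@has_size P n) c -> lmap (sd apex n c) = sd apex' n (lmap c).
Proof.
elim: n c => [|n IH] c //.
apply: (@supp_in_additive_ext _ _ _ _ (lmap \o sd apex n.+1)
  (sd apex' n.+1 \o lmap)) => l g ln.
change (lmap (sd apex n.+1 (single l g)) = sd apex' n.+1 (lmap (single l g))).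
rewrite lmap_single (sd_single apex) (sd_single apex') lmap_cone f_apex ?IH.
- by rewrite lmap_sbdry lmap_single.
- by apply: supp_in_sbdry; exact: supp_in_single.
- by rewrite ln.
Qed.

Lemma lmap_sdh n c :
  supp_in (@has_size P n) c -> lmap (sdh apex n c) = sdh apex' n (lmap c).
Proof.
elim: n c => [|n IH] c; first by rewrite /= raddf0.
apply: (@supp_in_additive_ext _ _ _ _ (lmap \o sdh apex n.+1)
  (sdh apex' n.+1 \o lmap)) => l g ln.
change (lmap (sdh apex n.+1 (single l g)) = sdh apex' n.+1 (lmap (single l g))).
rewrite lmap_single (sdh_single apex) (sdh_single apex') lmap_cone f_apex;
  last by rewrite ln.
rewrite (raddfB lmap) /= IH.
  by rewrite lmap_sbdry lmap_single.
by apply: supp_in_sbdry; exact: supp_in_single.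
Qed.

End OrderedChainMaps.
Arguments lmap {P P' G} f.

(** * Affine simplices and their mesh *)

Section AffineSimplices.
Variable R : realType.
Local Notation Delta n := (set_type (@stdsimplex R n)).

Definition crd n (x : Delta n) (i : 'I_n.+1) : R := (val x : 'rV_n.+1) 0 i.

Lemma crd_ge0 n (x : Delta n) i : 0 <= crd x i.
Proof. by have /set_mem[+ _] := valP x; exact. Qed.

Lemma crd_sum n (x : Delta n) : \sum_i crd x i = 1.
Proof. by have /set_mem[] := valP x. Qed.

Lemma crd_inj n (x y : Delta n) : crd x =1 crd y -> x = y.
Proof. by move=> xy; apply/val_inj/rowP => i; exact: xy. Qed.

Lemma crd_coface n (i : 'I_n.+2) (x : Delta n) j :
  crd (coface i x) j = if unlift i j is Some k then crd x k else 0.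
Proof. by rewrite /crd /= mxE. Qed.

Section Point.
Variables (n : nat) (f : 'I_n.+1 -> R).
Hypotheses (f0 : forall i, 0 <= f i) (f1 : \sum_i f i = 1).

Lemma point_stdsimplex : (\row_j f j) \in @stdsimplex R n.
Proof.
apply/mem_set; split=> [i|]; first by rewrite mxE.
by rewrite -[RHS]f1; apply: eq_bigr => i _; rewrite mxE.
Qed.

Definition point : Delta n :=
  exist (fun y => y \in @stdsimplex R n) _ point_stdsimplex.

Lemma crd_point i : crd point i = f i.
Proof. by rewrite /crd /= mxE. Qed.
End Point.

Lemma sum_delta n (F : 'I_n.+1 -> R) i : \sum_j (j == i)%:R * F j = F i.
Proof.
rewrite (bigD1 i) //= eqxx mul1r big1 ?addr0 // => j /negPf ->.
by rewrite mul0r.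
Qed.

Lemma vertex_sum n (i : 'I_n.+1) : \sum_j (j == i)%:R = 1 :> R.
Proof.
by rewrite -[RHS](sum_delta (fun=> 1) i); apply: eq_bigr => j _; rewrite mulr1.
Qed.

Definition vertex n (i : 'I_n.+1) : Delta n :=
  point (fun j => ler0n _ _) (vertex_sum i).

Lemma crd_vertex n (i j : 'I_n.+1) : crd (vertex i) j = (j == i)%:R.
Proof. by rewrite crd_point. Qed.

Section Affine.
Variables (m n : nat) (l : seq (Delta m)).
Local Notation p i := (nth (vertex ord0) l i).

Lemma affine_ge0 (x : Delta n) j : 0 <= \sum_(i < n.+1) crd x i * crd (p i) j.
Proof. by apply: sumr_ge0 => i _; apply: mulr_ge0; exact: crd_ge0. Qed.

Lemma affine_sum (x : Delta n) :
  \sum_j \sum_(i < n.+1) crd x i * crd (p i) j = 1.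
Proof.
rewrite exchange_big -[RHS](crd_sum x); apply: eq_bigr => i _.
by rewrite -mulr_sumr crd_sum mulr1.
Qed.

(** The barycentric combination of the entries of [l] with weights the coordinates of [x]. Missing
    entries are read as the vertex 0, so the map is defined for every list and a length is assumed
    only where it matters. *)
Definition affine (x : Delta n) : Delta m := point (affine_ge0 x) (affine_sum x).

Lemma crd_affine x j : crd (affine x) j = \sum_(i < n.+1) crd x i * crd (p i) j.
Proof. by rewrite crd_point. Qed.

Lemma crd_continuous i : continuous (fun x : Delta n => crd x i).
Proof.
move=> x; apply: (@continuous_comp _ _ _ set_val (fun M : 'rV[R]_n.+1 => M 0 i)).
  exact: initial_continuous.
exact: coord_continuous.
Qed.

Lemma continuous_affine : continuous affine.
Proof.
apply: continuous_comp_initial => /= x A [P Px PA].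
have cj : \forall y \near x, forall j, P 0 j (crd (affine y) j).
  have Fx : Filter (nbhs x) := nbhs_filter x.
  apply: (@filter_forall _ _ (fun j y => P 0 j (crd (affine y) j)) _ Fx) => j.
  have: {for x, continuous (fun y => crd (affine y) j)}.
    rewrite (_ : (fun y => _) =
        (fun y => \sum_(i < n.+1) crd y i * crd (p i) j)).
      apply: cvg_big => [|i _]; first exact: add_continuous.
      by apply: cvgM; [exact: crd_continuous|exact: cvg_cst].
    by apply/funext => y; exact: crd_affine.
  by apply; have := Px 0 j.
apply: filterS cj => y Py; apply: PA => a j; rewrite (ord1 a).
exact: Py.
Qed.

HB.instance Definition _ := isContinuous.Build _ _ affine continuous_affine.
End Affine.
Arguments affine {m} n l.

(** The coordinate inserted by the coface is 0, so the i-th vertex drops out of the combination.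
    This is what makes [push] below compatible with boundaries. *)
Lemma affine_coface m n (l : seq (Delta m)) (i : 'I_n.+2) x :
  affine n.+1 l (coface i x) = affine n (del i l) x.
Proof.
apply: crd_inj => j; rewrite !crd_affine (bigD1_ord i) //= crd_coface.
rewrite unlift_none mul0r add0r; apply: eq_bigr => k _.
by rewrite crd_coface liftK nth_del.
Qed.

Definition ordered_vertices n : seq (Delta n) :=
  [seq vertex i | i <- enum 'I_n.+1].

Lemma size_ordered_vertices n : size (ordered_vertices n) = n.+1.
Proof. by rewrite size_map size_enum_ord. Qed.

Lemma nth_ordered_vertices n x0 (i : 'I_n.+1) :
  nth x0 (ordered_vertices n) i = vertex i.
Proof. by rewrite (nth_map ord0) ?size_enum_ord // nth_ord_enum. Qed.

Lemma affine_ordered_vertices n x : affine n (ordered_vertices n) x = x.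
Proof.
apply: crd_inj => j; rewrite crd_affine.
under eq_bigr => i _ do rewrite nth_ordered_vertices crd_vertex eq_sym mulrC.
exact: sum_delta.
Qed.

Lemma affine_vertex m n (l : seq (Delta m)) (i : 'I_n.+1) :
  affine n l (vertex i) = nth (vertex ord0) l i.
Proof.
apply: crd_inj => j; rewrite crd_affine.
under eq_bigr => k _ do rewrite crd_vertex.
exact: sum_delta.
Qed.

Lemma map_affine_ordered_vertices m n (l : seq (Delta m)) :
  size l = n.+1 -> map (affine n l) (ordered_vertices n) = l.
Proof.
move=> ln; apply: (@eq_from_nth _ (vertex ord0)).
  by rewrite size_map size_ordered_vertices ln.
move=> i; rewrite size_map size_ordered_vertices => ilt.
rewrite (nth_map (vertex ord0)) ?size_ordered_vertices //.
by rewrite (nth_ordered_vertices _ (Ordinal ilt)) affine_vertex.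
Qed.

Lemma affine_affine m n k (l : seq (Delta m)) (l' : seq (Delta n)) x :
  size l' = k.+1 ->
  affine n l (affine k l' x) = affine k (map (affine n l) l') x.
Proof.
move=> ln; apply: crd_inj => j; rewrite !crd_affine.
under eq_bigr do rewrite crd_affine mulr_suml.
rewrite exchange_big; apply: eq_bigr => i _ /=.
rewrite (nth_map (vertex ord0)) ?ln // crd_affine mulr_sumr.
by apply: eq_bigr => a _; rewrite mulrA.
Qed.

Lemma barycenter_ge0 n (i : 'I_n.+1) : 0 <= n.+1%:R^-1 :> R.
Proof. by rewrite invr_ge0. Qed.

Lemma barycenter_sum n : \sum_(i < n.+1) n.+1%:R^-1 = 1 :> R.
Proof. by rewrite sumr_const card_ord -[LHS]mulr_natl divff ?pnatr_eq0. Qed.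

(** Defined as the affine image of the central point, so that commutation with affine maps is a case
    of [affine_affine]; [crd_barycenter] recovers the average of the vertices. *)
Definition barycenter m (l : seq (Delta m)) : Delta m :=
  affine (size l).-1 l (point (@barycenter_ge0 (size l).-1) (barycenter_sum _)).

Lemma crd_barycenter m (l : seq (Delta m)) j : (0 < size l)%N ->
  crd (barycenter l) j = (size l)%:R^-1 * \sum_(p <- l) crd p j.
Proof.
move=> l0; rewrite crd_affine; under eq_bigr do rewrite crd_point.
rewrite (big_nth (vertex ord0)) big_mkord mulr_sumr.
by case: (size l) l0 => // k _; apply: eq_bigr.
Qed.

Lemma affine_barycenter m n (l : seq (Delta m)) (l' : seq (Delta n)) :
  (0 < size l')%N ->
  affine n l (barycenter l') = barycenter (map (affine n l) l').
Proof.
by move=> l0; rewrite /barycenter affine_affine ?prednK // size_map.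
Qed.

Definition crd_between m (j : 'I_m.+1) (a b : R) : set (Delta m) :=
  [set p | a <= crd p j <= b].

Lemma crd_between_affine m n (l : seq (Delta m)) j a b x : size l = n.+1 ->
  all_in (crd_between j a b) l -> crd_between j a b (affine n l x).
Proof.
move=> ln lab; rewrite /crd_between /= crd_affine.
have pab (i : 'I_n.+1) : a <= crd (nth (vertex ord0) l i) j <= b.
  by apply: lab; rewrite mem_nth ?ln.
have cE c : c = \sum_(i < n.+1) crd x i * c by rewrite -mulr_suml crd_sum mul1r.
apply/andP; split; [rewrite [X in X <= _]cE | rewrite [X in _ <= X]cE];
  apply: ler_sum => i _; apply: ler_wpM2l; rewrite ?crd_ge0 //;
  by have /andP[] := pab i.
Qed.

Lemma crd_between_barycenter m (l : seq (Delta m)) j a b : (0 < size l)%N ->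
  all_in (crd_between j a b) l -> crd_between j a b (barycenter l).
Proof. by move=> l0; apply: crd_between_affine; rewrite prednK. Qed.

Variable G : zmodType.

(** A slab is convex, hence stable under barycenters. Sup-norm balls are intersections of slabs, so
    this controls distances one coordinate at a time. *)
Lemma crd_between_sd m n j a b (c : fchain (seq (Delta m)) G) :
  supp_in (@has_size _ n `&` all_in (crd_between j a b)) c ->
  supp_in (@has_size _ n `&` all_in (crd_between j a b)) (sd (@barycenter m) n c).
Proof.
elim: n c => [|n IH] c //.
apply: (supp_in_additive (f := sd _ n.+1)) => l g [ln lab]; rewrite sd_single.
apply: (@supp_in_cone _ _ (@has_size _ n `&` all_in (crd_between j a b))).
  move=> l' [l'n l'ab]; split; first by rewrite /has_size /= l'n.
  move=> p; rewrite inE => /orP[/eqP ->|]; last exact: l'ab.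
  by apply: crd_between_barycenter; rewrite ?ln.
apply: IH; apply: supp_in_sbdry_single => i il; split.
  by rewrite /has_size /= size_del // ln.
exact: del_all_in.
Qed.

Definition mesh_le m (d : R) (l : seq (Delta m)) :=
  forall p q, p \in l -> q \in l -> forall j, `|crd p j - crd q j| <= d.

(** In the average of the differences q - p over the vertices q, the term q = p vanishes. With s
    vertices this leaves the factor (s - 1) / s, which is at most n / (n + 1). *)
Lemma crd_barycenter_dist m n (d : R) (l : seq (Delta m)) p j : 0 <= d ->
  (0 < size l <= n.+1)%N -> mesh_le d l -> p \in l ->
  `|crd (barycenter l) j - crd p j| <= (n%:R / n.+1%:R) * d.
Proof.
move=> d0 /andP[l0 ln] ld pl.
have s0 : (size l)%:R != 0 :> R by rewrite pnatr_eq0 -lt0n.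
have -> : crd (barycenter l) j - crd p j =
    (size l)%:R^-1 * \sum_(q <- l) (crd q j - crd p j).
  rewrite crd_barycenter // sumrB mulrBr; congr (_ - _).
  by rewrite big_const_seq count_predT iter_addr_0 -[crd p j *+ _]mulr_natl mulKf.
rewrite normrM ger0_norm ?invr_ge0 // (big_rem p) //= subrr add0r.
apply: (@le_trans _ _ ((size l)%:R^-1 * (\sum_(q <- rem p l) d))).
  apply: ler_wpM2l; first by rewrite invr_ge0.
  apply: (le_trans (ler_norm_sum _ _ _)).
  rewrite big_seq [leRHS]big_seq; apply: ler_sum => q /mem_rem ql.
  exact: ld.
rewrite big_const_seq count_predT iter_addr_0 size_rem // -[d *+ _]mulr_natl mulrA.
apply: ler_wpM2r => //; case: (size l) l0 ln => // k _ kn /=.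
rewrite ler_pdivlMr ?ltr0n // mulrAC -mulrA mulrC ler_pdivrMr ?ltr0n //.
rewrite -!natrM ler_nat; lia.
Qed.

(** A simplex of the subdivision is the barycenter joined to a simplex of the subdivided boundary.
    Distances inside the latter are bounded by induction, those to the barycenter by
    [crd_barycenter_dist]. [N] stays fixed while [n] decreases, so that one ratio serves
    throughout. *)
Lemma mesh_le_sd m n N (d : R) (c : fchain (seq (Delta m)) G) : 0 <= d ->
  (n <= N.+1)%N ->
  supp_in (@has_size _ n `&` mesh_le d) c ->
  supp_in (@has_size _ n `&` mesh_le (N%:R / N.+1%:R * d))
    (sd (@barycenter m) n c).
Proof.
move=> d0; elim: n c => [|n IH] c nN.
  move=> cd l /cd [l0 _]; split => // p q; rewrite /has_size /= in l0.
  by rewrite (size0nil l0).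
apply: (supp_in_additive (f := sd _ n.+1)) => l g [ln ld]; rewrite sd_single.
set r := _ / _ * _.
have s1 : supp_in (@has_size _ n `&` mesh_le r)
    (sd (@barycenter m) n (sbdry (single l g))).
  apply: IH; first exact: ltnW.
  apply: supp_in_sbdry_single => i il; split.
    by rewrite /has_size /= size_del // ln.
  by move=> p q /(mem_subseq (del_subseq _ _)) pl
    /(mem_subseq (del_subseq _ _)) ql j; exact: ld.
(* All vertices of [l] lie within [r] of the barycenter, and by convexity so do the vertices created
   when the boundary is subdivided. *)
have s2 j : supp_in (@has_size _ n `&` all_in
      (crd_between j (crd (barycenter l) j - r) (crd (barycenter l) j + r)))
    (sd (@barycenter m) n (sbdry (single l g))).
  apply: crd_between_sd; apply: supp_in_sbdry_single => i il; split.
    by rewrite /has_size /= size_del // ln.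
  apply: del_all_in => p pl; rewrite /crd_between /= -ler_distlC distrC.
  by rewrite distrC; apply: crd_barycenter_dist; rewrite ?ln.
set c' := sd _ n _ in s1 s2 *.
apply: (@supp_in_cone _ _ [set l' | (@has_size _ n `&` mesh_le r) l' /\
   forall j, all_in (crd_between j (crd (barycenter l) j - r)
     (crd (barycenter l) j + r)) l']).
  move=> l' [[l'n l'r] l'b]; split; first by rewrite /has_size /= l'n.
  have bd q j : q \in l' -> `|crd (barycenter l) j - crd q j| <= r.
    by move=> /(l'b j); rewrite /crd_between /= -ler_distl distrC.
  move=> p q; rewrite !inE => /orP[/eqP ->|pl'] /orP[/eqP ->|ql'] j.
  - by rewrite subrr normr0 /r mulr_ge0 // divr_ge0.
  - exact: bd.
  - by rewrite distrC; exact: bd.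
  - exact: l'r.
by move=> l' cl'; split; [exact: s1|move=> j; have [] := s2 j _ cl'].
Qed.

End AffineSimplices.
Arguments affine {R m} n l.
Arguments ordered_vertices {R} n.

(** * Lebesgue's number lemma on the standard simplex *)

Section Lebesgue.
Variables (R : realType) (n : nat).
Local Notation Delta n := (set_type (@stdsimplex R n)).

Lemma compact_stdsimplex : compact (@stdsimplex R n).
Proof.
apply: (@subclosed_compact _ _
  [set v : 'rV[R]_n.+1 | forall i, v ord0 i \in `[0, 1]]).
- have -> : @stdsimplex R n =
      (\bigcap_i (fun x : 'rV[R]_n.+1 => x 0 i) @^-1` [set t | 0 <= t]) `&`
    (fun x : 'rV[R]_n.+1 => \sum_i x 0 i) @^-1` [set 1].
    apply/seteqP; split=> x [x0 x1]; split=> //; first by move=> i _; exact: x0.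
    by move=> i; exact: x0.
  apply: closedI.
    apply: closed_bigI => i _; apply: preimage_closed; last exact: closed_ge.
    by move=> x _; exact: coord_continuous.
  apply: preimage_closed; last exact: closed_eq.
  move=> x _; have Fx : Filter (nbhs x) := nbhs_filter x.
  apply: cvg_big => [|i _]; first exact: add_continuous.
  exact: coord_continuous.
- by apply: (@rV_compact R _ (fun=> `[0, 1]%classic)) => i; exact: segment_compact.
- move=> x [x0 x1] i; rewrite in_itv /= x0 -x1 (bigD1 i) //= lerDl.
  by apply: sumr_ge0 => k _; exact: x0.
Qed.

Variables (X : topologicalType) (I : Type) (U : I -> set X).
Hypotheses (Uopen : forall i, open (U i)) (Ucover : \bigcup_i U i = [set: X]).

(** Compactness is used in its near-covering form: [P e] holds at all points near a given one for
    all small positive [e], hence on the whole simplex for a common [e]. *)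
Lemma lebesgue_number (s : continuousType (Delta n) X) :
  exists2 d : R, 0 < d & forall x : Delta n, exists i, forall y : Delta n,
    (forall j, `|crd x j - crd y j| < d) -> U i (s y).
Proof.
pose P (e : R) (M : 'rV[R]_n.+1) := exists i, forall y : Delta n,
  (forall j, `|M 0 j - crd y j| < e) -> U i (s y).
have /compact_near_coveringP cov := compact_stdsimplex.
have {}cov : \forall e \near (0 : R)^'+, @stdsimplex R n `<=` P e.
  apply: cov => M KM; pose x : Delta n := exist _ M (mem_set KM).
  have [i _ Ui] : (\bigcup_i U i) (s x) by rewrite Ucover.
  have : nbhs x (s @^-1` U i).
    by apply: (@cts_fun _ _ s); apply: open_nbhs_nbhs; split.
  move=> [_ [[B oB <-] Bx BU]].
  have /nbhs_ballP[e /= e0 eB] : nbhs M B by apply: open_nbhs_nbhs; split.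
  (* Half for the moving centre [M'] and half for [e'], so that the triangle inequality ends in the
     ball of radius [e] around [M]. *)
  exists (ball M (e / 2), [set e' | e' < e / 2]); first split => /=.
  - by apply: nbhsx_ballx; rewrite divr_gt0.
  - by apply: nbhs_right_lt; rewrite divr_gt0.
  move=> [M' e'] [/= MM' e'e]; exists i => y My; apply: BU => /=; apply: eB.
  split => // a j; rewrite (ord1 a).
  have := My j; rewrite /ball /= /crd => My'.
  have [_ /(_ 0 j)] := MM'; rewrite /ball /= => MM'j.
  have := ler_distD (M' 0 j) (M 0 j) (\val y 0 j); lra.
have [d [d0 dP]] : exists d : R, 0 < d /\ @stdsimplex R n `<=` P d.
  apply: (filter_ex (F := (0 : R)^'+)); apply: filterI => //.
  exact: nbhs_right_gt.
exists d => // x; have [i xi] := dP (val x) (set_mem (valP x)).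
by exists i.
Qed.

Lemma affine_small (s : continuousType (Delta n) X) :
  exists2 d : R, 0 < d & forall k (l : seq (Delta n)), size l = k.+1 ->
    mesh_le d l -> exists i, forall x, U i (s (affine k l x)).
Proof.
(* The slabs bound the distance to the first vertex by the mesh non-strictly; halving [d] gives the
   strict inequality required by [lebesgue_number]. *)
have [d d0 sd] := lebesgue_number s; exists (d / 2); first by rewrite divr_gt0.
move=> k l lk lmesh; have [i Ui] := sd (nth (vertex R ord0) l 0).
exists i => x; apply: Ui => j; set p := nth _ _ _.
have pl : p \in l by rewrite mem_nth ?lk.
have : crd_between j (crd p j - d / 2) (crd p j + d / 2) (affine k l x).
  apply: crd_between_affine => // q ql.
  by rewrite /crd_between /= -ler_distl distrC; exact: lmesh.
rewrite /crd_between /= -ler_distl distrC => /le_lt_trans; apply; lra.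
Qed.

End Lebesgue.

(** * Small singular chains *)

Section SingularSubdivision.
Variables (R : realType) (G : zmodType) (X : topologicalType).
Local Notation Delta n := (set_type (@stdsimplex R n)).
Local Notation S n := (fchain (simplex (singular R X) n) G).

Definition carried (A : set X) n : set (simplex (singular R X) n) :=
  [set s : continuousType (Delta n) X | forall x, A (s x)].

Definition affine_simplex m n (s : continuousType (Delta m) X)
  (l : seq (Delta m)) : simplex (singular R X) n :=
  (s \o affine n l : continuousType _ _).

Lemma affine_simplex_ordered_vertices n s :
  affine_simplex n s (ordered_vertices n) = s.
Proof.
by apply/continuousEP => x; rewrite /affine_simplex /= affine_ordered_vertices.
Qed.

Lemma affine_simplex_affine m n k (s : continuousType (Delta m) X)
    (l : seq (Delta m)) (l' : seq (Delta k)) : size l' = n.+1 ->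
  affine_simplex n (affine_simplex k s l) l' =
  affine_simplex n s (map (affine k l) l').
Proof.
by move=> l'n; apply/continuousEP => x; rewrite /affine_simplex /= affine_affine.
Qed.

Definition push m n (s : continuousType (Delta m) X) :
    fchain (seq (Delta m)) G -> S n :=
  lin (fun l => single (affine_simplex n s l)).

HB.instance Definition _ m n s := GRing.isZmodMorphism.Build _ _ (@push m n s)
  (@lin_is_zmod_morphism _ _ _ (fun l => single (affine_simplex n s l))).

Lemma push_single m n s (l : seq (Delta m)) g :
  push n s (single l g) = single (affine_simplex n s l) g.
Proof. by rewrite /push lin_single. Qed.

Lemma push_ordered_vertices n s g :
  push n s (single (ordered_vertices n) g) = single s g.
Proof. by rewrite push_single affine_simplex_ordered_vertices. Qed.

Lemma bdry_push m n s c : supp_in (@has_size (Delta m) n.+2) c ->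
  bdry (push n.+1 s c) = push n s (sbdry c).
Proof.
move: c; apply: (@supp_in_additive_ext _ _ _ _ 
  (@bdry (singular R X) G n \o push n.+1 s) (push n s \o sbdry)) => l g ln /=.
rewrite push_single sbdry_single bdry_single (raddf_sum (push n s)) ln.
apply: eq_bigr => i _ /=; rewrite push_single; congr (single _ _).
by apply/continuousEP => x; rewrite /affine_simplex /= affine_coface.
Qed.

Lemma push_affine m n k s (l : seq (Delta m)) c :
  supp_in (@has_size (Delta k) n.+1) c ->
  push n (affine_simplex k s l) c = push n s (lmap (affine k l) c).
Proof.
move: c; apply: (@supp_in_additive_ext _ _ _ _ (push n _)
  (push n s \o lmap _)) => l' g l'n /=.
by rewrite push_single lmap_single push_single affine_simplex_affine.
Qed.

Lemma push_carried (A : set X) m n s (c : fchain (seq (Delta m)) G) :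
  @carried A m s -> supp_in (@carried A n) (push n s c).
Proof.
move=> sA; have := @supp_inT _ _ c; move: c; apply: supp_in_additive => l g _.
by rewrite /= push_single; apply: supp_in_single => x; exact: sA.
Qed.

(** Subdivision is carried out once on the model list [ordered_vertices n] in the standard simplex
    and transported to X along [s] by [push]; the homotopy below is built in the same way. *)
Definition subdivision n : S n -> S n :=
  lin (fun s => push n s \o sd (@barycenter R n) n.+1 \o
                single (ordered_vertices n)).

HB.instance Definition _ n := GRing.isZmodMorphism.Build _ _ (@subdivision n)
  (@lin_is_zmod_morphism _ _ _ (fun s => push n s \o
     sd (@barycenter R n) n.+1 \o single (ordered_vertices n))).

Definition subdivision_homotopy n : S n -> S n.+1 :=
  lin (fun s => push n.+1 s \o sdh (@barycenter R n) n.+1 \o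
                single (ordered_vertices n)).

HB.instance Definition _ n :=
  GRing.isZmodMorphism.Build _ _ (@subdivision_homotopy n)
  (@lin_is_zmod_morphism _ _ _ (fun s => push n.+1 s \o
     sdh (@barycenter R n) n.+1 \o single (ordered_vertices n))).

Lemma supp_ordered_vertices n (g : G) :
  supp_in (@has_size (Delta n) n.+1) (single (ordered_vertices n) g).
Proof.
by apply: supp_in_single; rewrite /has_size /= size_ordered_vertices.
Qed.

Arguments supp_ordered_vertices : clear implicits.

(** Affine maps commute with barycenters, so subdividing after [push] agrees with subdividing
    before. Identities on singular chains thereby reduce to those on lists. *)
Lemma subdivision_push m n s c : supp_in (@has_size (Delta m) n.+1) c ->
  subdivision (push n s c) = push n s (sd (@barycenter R m) n.+1 c).
Proof.
move: c; apply: (@supp_in_additive_ext _ _ _ _ (@subdivision n \o push n s)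
  (push n s \o sd (@barycenter R m) n.+1)) => l g ln.
change (subdivision (push n s (single l g)) =
  push n s (sd (@barycenter R m) n.+1 (single l g))).
rewrite push_single /subdivision lin_single /=.
have sz := supp_ordered_vertices n g.
rewrite push_affine; last exact: supp_in_sd.
rewrite (lmap_sd (apex' := @barycenter R m) _ sz) => [|l' l'0]; last first.
  exact: affine_barycenter.
by rewrite lmap_single map_affine_ordered_vertices.
Qed.

Lemma subdivision_homotopy_push m n s c :
  supp_in (@has_size (Delta m) n.+1) c ->
  subdivision_homotopy (push n s c) = push n.+1 s (sdh (@barycenter R m) n.+1 c).
Proof.
move: c; apply: (@supp_in_additive_ext _ _ _ _
  (@subdivision_homotopy n \o push n s)
  (push n.+1 s \o sdh (@barycenter R m) n.+1)) => l g ln.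
change (subdivision_homotopy (push n s (single l g)) =
  push n.+1 s (sdh (@barycenter R m) n.+1 (single l g))).
rewrite push_single /subdivision_homotopy lin_single /=.
have sz := supp_ordered_vertices n g.
rewrite push_affine; last exact: supp_in_sdh.
rewrite (lmap_sdh (apex' := @barycenter R m) _ sz) => [|l' l'0]; last first.
  exact: affine_barycenter.
by rewrite lmap_single map_affine_ordered_vertices.
Qed.

Lemma bdry_subdivision n (c : S n.+1) : bdry (subdivision c) = subdivision (bdry c).
Proof.
move: c; apply: (@additive_ext _ _ _ (@bdry (singular R X) G n \o @subdivision n.+1)
  (@subdivision n \o @bdry (singular R X) G n)) => s g /=.
have sz := supp_ordered_vertices n.+1 g.
(* The generator is rewritten as the [push] of its model chain, on which the identity is
   [sbdry_sd]. *)
rewrite -(push_ordered_vertices s) subdivision_push // !bdry_push //; last first.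
  exact: supp_in_sd.
by rewrite subdivision_push ?sbdry_sd //; exact: supp_in_sbdry.
Qed.

Lemma bdry_subdivision_homotopy0 (c : S 0) :
  bdry (subdivision_homotopy c) = c - subdivision c.
Proof.
move: c; apply: (@additive_ext _ _ _
  (@bdry (singular R X) G 0 \o @subdivision_homotopy 0)
  (idfun \- @subdivision 0)) => s g /=.
have sz := supp_ordered_vertices 0 g.
rewrite -(push_ordered_vertices s) subdivision_push //.
rewrite subdivision_homotopy_push // bdry_push; last exact: supp_in_sdh.
(* In degree 0 the list boundary is a multiple of the empty list, and [sdh 0] kills it. *)
by rewrite -raddfB -sbdry_sdh sdh0 addr0.
Qed.

Lemma bdry_subdivision_homotopy n (c : S n.+1) :
  bdry (subdivision_homotopy c) + subdivision_homotopy (bdry c) =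
  c - subdivision c.
Proof.
move: c; apply: (@additive_ext _ _ _
  ((@bdry (singular R X) G n.+1 \o @subdivision_homotopy n.+1) \+
   (@subdivision_homotopy n \o @bdry (singular R X) G n))
  (idfun \- @subdivision n.+1)) => s g /=.
have sz := supp_ordered_vertices n.+1 g.
rewrite -(push_ordered_vertices s) subdivision_push // bdry_push //.
rewrite !subdivision_homotopy_push //; last exact: supp_in_sbdry.
rewrite bdry_push; last exact: supp_in_sdh.
by rewrite -raddfB -sbdry_sdh raddfD.
Qed.

Section Small.
Variables (I : Type) (U : I -> set X).

Definition small n : set (simplex (singular R X) n) :=
  [set s | exists i, carried (U i) s].

Lemma small_subdivision n (c : S n) :
  supp_in (@small n) c -> supp_in (@small n) (subdivision c).
Proof.
move: c; apply: supp_in_additive => s g [i si].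
rewrite /= /subdivision lin_single.
apply: (@sub_supp_in _ _ (@carried (U i) n)) => [t ti|]; first by exists i.
exact: push_carried.
Qed.

Lemma small_subdivision_homotopy n (c : S n) :
  supp_in (@small n) c -> supp_in (@small n.+1) (subdivision_homotopy c).
Proof.
move: c; apply: supp_in_additive => s g [i si].
rewrite /= /subdivision_homotopy lin_single.
apply: (@sub_supp_in _ _ (@carried (U i) n.+1)) => [t ti|]; first by exists i.
exact: push_carried.
Qed.

Lemma small_iter_subdivision n m (c : S n) :
  supp_in (@small n) c -> supp_in (@small n) (iter m (@subdivision n) c).
Proof. by move=> sc; elim: m => //= m; exact: small_subdivision. Qed.

Lemma iter_subdivisionD n m (c d : S n) : iter m (@subdivision n) (c + d) =
  iter m (@subdivision n) c + iter m (@subdivision n) d.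
Proof. by elim: m => //= m ->; rewrite raddfD. Qed.

Lemma bdry_iter_subdivision n m (c : S n.+1) :
  bdry (iter m (@subdivision n.+1) c) = iter m (@subdivision n) (bdry c).
Proof. by elim: m => //= m <-; rewrite bdry_subdivision. Qed.

Lemma cycles_subdivision n (c : S n) :
  c \in @cycles _ G n -> subdivision c \in @cycles _ G n.
Proof.
case: n c => // n c; rewrite !unfold_in /= => /eqP c0.
by rewrite bdry_subdivision c0 raddf0.
Qed.

Lemma subdivision_homology n (c : S n) : c \in @cycles _ G n ->
  c - subdivision c = bdry (subdivision_homotopy c).
Proof.
case: n c => [|n] c; first by rewrite bdry_subdivision_homotopy0.
rewrite unfold_in /= => /eqP c0.
by rewrite -bdry_subdivision_homotopy c0 raddf0 addr0.
Qed.

(** The one-step homologies telescope. The second clause records that a small cycle is moved through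
    small chains only, as [small_boundary] needs. *)
Lemma iter_subdivision_homology n m (c : S n) : c \in @cycles _ G n ->
  exists b, c - iter m (@subdivision n) c = bdry b /\
    (supp_in (@small n) c -> supp_in (@small n.+1) b).
Proof.
elim: m c => [|m IH] c cZ.
  by exists 0; rewrite subrr raddf0; split=> // _; exact: supp_in0.
have [b [bE bs]] := IH _ (cycles_subdivision cZ).
exists (subdivision_homotopy c + b).
rewrite iterSr raddfD /= -bE -subdivision_homology //.
split; first by rewrite addrA subrK.
move=> cs; apply: supp_inD; first exact: small_subdivision_homotopy.
exact/bs/small_subdivision.
Qed.

Hypotheses (Uopen : forall i, open (U i)) (Ucover : \bigcup_i U i = [set: X]).

Lemma iter_subdivision_push m n s c : supp_in (@has_size (Delta n) n.+1) c ->
  iter m (@subdivision n) (push n s c) =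
  push n s (iter m (sd (@barycenter R n) n.+1) c).
Proof.
elim: m c => // m IH c sc.
by rewrite !iterSr subdivision_push // IH //; exact: supp_in_sd.
Qed.

Lemma mesh_iter_sd n m (g : G) :
  supp_in (@has_size (Delta n) n.+1 `&` mesh_le ((n%:R / n.+1%:R) ^+ m))
    (iter m (sd (@barycenter R n) n.+1) (single (ordered_vertices n) g)).
Proof.
elim: m => [|m IH] /=; last first.
  by rewrite exprS; apply: mesh_le_sd => //; rewrite exprn_ge0 // divr_ge0.
apply: supp_in_single; split; first exact: size_ordered_vertices.
move=> p q _ _ j; have crd_le1 (x : Delta n) : crd x j <= 1.
  rewrite -(crd_sum x) (bigD1 j) //= lerDl.
  by apply: sumr_ge0 => i _; exact: crd_ge0.
rewrite expr0 ler_norml.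
have := crd_ge0 p j; have := crd_ge0 q j.
by have := crd_le1 p; have := crd_le1 q; lra.
Qed.

Lemma eventually_small n (c : S n) :
  exists m, supp_in (@small n) (iter m (@subdivision n) c).
Proof.
have := @supp_inT _ _ c; move: c; apply: supp_in_ind.
- by exists 0%N; exact: supp_in0.
(* Smallness survives further subdivision, so [m1 + m2] rounds serve both summands. *)
- move=> c d [m1 c1] [m2 d2]; exists (m1 + m2)%N; rewrite iter_subdivisionD.
  apply: supp_inD; last by rewrite iterD; exact: small_iter_subdivision.
  by rewrite addnC iterD; exact: small_iter_subdivision.
(* Each round multiplies the mesh bound by n / (n + 1), so it eventually falls below the bound [d]
   attached to [s]. *)
move=> s g _; have [d d0 sd] := affine_small Uopen Ucover s.
have [m md] : exists m, (n%:R / n.+1%:R) ^+ m < d.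
  have r1 : `|n%:R / n.+1%:R| < 1 :> R.
    by rewrite ger0_norm ?divr_ge0 // ltr_pdivrMr ?ltr0n // mul1r ltr_nat.
  have [m _ /(_ m (leqnn m)) md] : \forall m \near \oo, (n%:R / n.+1%:R) ^+ m < d.
    exact: (cvgr_lt (0 : R) (cvg_expr r1)).
  by exists m.
exists m; rewrite -(push_ordered_vertices s) iter_subdivision_push; last first.
  exact: supp_ordered_vertices.
have := @mesh_iter_sd n m g; move: (iter _ _ _).
apply: supp_in_additive => l h [ln lm]; rewrite /= push_single.
apply: supp_in_single; apply: (sd n l ln).
by move=> p q pl ql j; apply: (le_trans (lm p q pl ql j)); exact: ltW.
Qed.

Lemma homologous_small n (c : S n) : c \in @cycles _ G n ->
  exists c' b, [/\ supp_in (@small n) c', c' \in @cycles _ G n & c - c' = bdry b].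
Proof.
move=> cZ; have [m cm] := eventually_small c.
have [b [bE _]] := iter_subdivision_homology m cZ.
exists (iter m (@subdivision n) c), b; split => //.
by elim: m {cm bE} => //= m; exact: cycles_subdivision.
Qed.

(** Subdivide [b] until it is small. Its boundary is then the subdivided [c], which differs from [c]
    by the boundary of a small chain [e] because [c] is small. *)
Lemma small_boundary n (c : S n) (b : S n.+1) :
  supp_in (@small n) c -> c = bdry b ->
  exists2 b', supp_in (@small n.+1) b' & c = bdry b'.
Proof.
move=> cs cb; have [m bm] := eventually_small b.
have cZ : c \in @cycles _ G n.
  by rewrite cb; case: n {c cs cb m bm} b => // n b; rewrite unfold_in /= bdry_bdry.
have [e [eE es]] := iter_subdivision_homology m cZ.
exists (e + iter m (@subdivision n.+1) b).
  by apply: supp_inD => //; exact: es.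
by rewrite raddfD /= -eE bdry_iter_subdivision -cb subrK.
Qed.

End Small.
End SingularSubdivision.

(** * Contraction of a full simplex *)

Section FullSimplex.
Variables (I : choiceType) (K : scomplex I) (V : zmodType).
Local Notation C p := (fchain (simplex (simplicial K) p) V).

Definition nsimplex_of p (t : {fset I}) (tp : K t /\ #|` t| = p.+1) :
    nsimplex K p :=
  exist (fun t => t \in [set s | K s /\ #|` s| = p.+1]) t (mem_set tp).

Lemma nsimplexP p (s : nsimplex K p) : K (val s) /\ #|` val s| = p.+1.
Proof. exact: set_mem (valP s). Qed.

Lemma val_face p (i : 'I_p.+2) (s : nsimplex K p.+1) :
  val (simplicial_face i s) = del_vertex i (val s).
Proof. by []. Qed.

Variables (J : set I) (m : I).
Hypotheses (Jm : J m) (m_min : forall x, J x -> vle m x).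
Hypothesis JK : forall s : {fset I}, s != fset0 ->
  (forall x, x \in s -> J x) -> K s.

Definition spanned p : set (simplex (simplicial K) p) :=
  [set s : nsimplex K p | forall x, x \in val s -> J x].

(* When m is already a vertex of s, the set m |` s has the wrong cardinal and the
   value is 0. *)
Definition join_fun p (s : nsimplex K p) : {additive V -> C p.+1} :=
  if pselect (K (m |` val s)%fset /\ #|` (m |` val s)%fset| = p.+2) is left sp
  then single (nsimplex_of sp) else \0.

Definition join p : C p -> C p.+1 := lin (@join_fun p).

HB.instance Definition _ p := GRing.isZmodMorphism.Build (C p) (C p.+1) (@join p)
  (@lin_is_zmod_morphism _ _ _ (@join_fun p)).

Lemma join_notin p (s : nsimplex K p) (t : nsimplex K p.+1) g :
  val t = (m |` val s)%fset -> join (single s g) = single t g.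
Proof.
move=> ts; rewrite /join lin_single /join_fun; case: pselect => [sp|nsp].
  by have -> : t = nsimplex_of sp by exact: val_inj.
by case: nsp; rewrite -ts; exact: nsimplexP.
Qed.

Lemma join_in p (s : nsimplex K p) g : m \in val s -> join (single s g) = 0.
Proof.
move=> ms; rewrite /join lin_single /join_fun; case: pselect => // sp.
have [_ sp2] := sp; exfalso; move: sp2.
by rewrite mem_fset1U // (nsimplexP s).2 => /eqP; rewrite eqn_leq ltnn andbF.
Qed.

Lemma joinable p (s : nsimplex K p) : spanned s -> m \notin val s ->
  exists2 t : nsimplex K p.+1, val t = (m |` val s)%fset & spanned t.
Proof.
move=> sJ ms.
have tJ x : x \in (m |` val s)%fset -> J x.
  by rewrite !inE => /orP[/eqP ->|/sJ].
have tp : K (m |` val s)%fset /\ #|` (m |` val s)%fset| = p.+2.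
  split; last by rewrite cardfsU1 ms (nsimplexP s).2.
  by apply: JK => //; apply/fset0Pn; exists m; rewrite !inE eqxx.
by exists (nsimplex_of tp).
Qed.

Lemma fset_vertices (s : {fset I}) x : (x \in vertices s) = (x \in s).
Proof. by rewrite mem_sort. Qed.

(** Coning onto the least vertex puts it at the front of the ordered list, so [join] involves no
    sign and its faces are shifted by exactly one. *)
Lemma vertices_join (s : {fset I}) : (forall x, x \in s -> J x) -> m \notin s ->
  vertices (m |` s)%fset = m :: vertices s.
Proof.
move=> sJ ms.
have -> : (m |` s)%fset = [fset x in m :: vertices s]%fset.
  by apply/fsetP => x; rewrite !inE fset_vertices.
apply: vertices_fset; last by rewrite /= fset_vertices ms vertices_uniq.
rewrite /= path_min_sorted; first exact/sort_sorted/vle_total.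
by apply/allP => x; rewrite fset_vertices => /sJ /m_min.
Qed.

Lemma vertices_head (s : {fset I}) : (forall x, x \in s -> J x) -> m \in s ->
  exists l, vertices s = m :: l.
Proof.
move=> sJ ms; have := sort_sorted (@vle_total I) (enum_fset s).
rewrite -/(vertices s); have := fset_vertices s.
case: (vertices s) => [/(_ m)|x l /[dup] sE /(_ x)]; first by rewrite ms.
rewrite mem_head => xs /= /(order_path_min (@vle_trans I)) /allP xl.
exists l; congr (_ :: _); apply: (@vle_anti I).
rewrite m_min ?andbT; last by apply: sJ; rewrite -xs.
move: (sE m); rewrite ms inE => /orP[/eqP ->|/xl //].
by have := vle_total x x; rewrite orbb.
Qed.

Lemma face0_join p (s : nsimplex K p) (t : nsimplex K p.+1) :
  spanned s -> m \notin val s -> val t = (m |` val s)%fset ->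
  simplicial_face ord0 t = s.
Proof.
move=> sJ ms ts; apply/val_inj/fsetP => x.
rewrite val_face in_del_vertex ts vertices_join // /del /= drop0.
by rewrite fset_vertices.
Qed.

Lemma faceS_join p (i : 'I_p.+2) (s : nsimplex K p.+1) (t : nsimplex K p.+2) :
  spanned s -> m \notin val s -> val t = (m |` val s)%fset ->
  val (simplicial_face (lift ord0 i) t) =
  (m |` val (simplicial_face i s))%fset.
Proof.
move=> sJ ms ts; apply/fsetP => x.
rewrite !val_face in_del_vertex ts vertices_join // lift0.
by rewrite /del /= in_cons in_fset1U in_del_vertex.
Qed.

Lemma join_spanned p (c : C p) :
  supp_in (@spanned p) c -> supp_in (@spanned p.+1) (join c).
Proof.
move: c; apply: supp_in_additive => s g sJ /=.
have [ms|ms] := boolP (m \in val (s : nsimplex K p)).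
  by rewrite join_in //; exact: supp_in0.
have [t ts tJ] := joinable sJ ms.
by rewrite (join_notin _ ts); exact: supp_in_single.
Qed.

Lemma apex_simplex : exists2 a : nsimplex K 0, val a = [fset m]%fset & spanned a.
Proof.
have aJ x : x \in [fset m]%fset -> J x by rewrite inE => /eqP ->.
have a0 : K [fset m]%fset /\ #|` [fset m]%fset| = 1%N.
  split; last by rewrite cardfs1.
  by apply: JK => //; apply/fset0Pn; exists m; rewrite inE.
by exists (nsimplex_of a0).
Qed.

(** If m is not in s, face 0 of the join is s and the other faces cancel against the join of the
    boundary. If m is in s, the join of s is 0; every face but face 0 still contains m, and joining
    m to face 0 restores s. *)
Lemma bdry_join p (c : C p.+1) : supp_in (@spanned p.+1) c ->
  bdry (join c) + join (bdry c) = c.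
Proof.
move: c; apply: (@supp_in_additive_ext _ _ _ _
  ((@bdry (simplicial K) V p.+1 \o @join p.+1) \+
   (@join p \o @bdry (simplicial K) V p)) idfun) => s g sJ /=.
rewrite bdry_single (raddf_sum (@join p)) /=.
have [ms|ms] := boolP (m \in val (s : nsimplex K p.+1)).
  rewrite join_in // raddf0 add0r big_ord_recl expr0 mulr1z.
  have [l sl] := vertices_head sJ ms.
  have sF : val (s : nsimplex K p.+1) =
      (m |` val (simplicial_face ord0 s))%fset.
    apply/fsetP => x; rewrite -fset_vertices in_fset1U val_face in_del_vertex.
    by rewrite sl /del /= drop0 inE.
  rewrite (join_notin _ sF) big1 ?addr0 // => i _; apply: join_in.
  by rewrite val_face in_del_vertex sl lift0 /del /= mem_head.
have [t ts tJ] := joinable sJ ms.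
rewrite (join_notin _ ts) bdry_single big_ord_recl expr0 mulr1z /=.
rewrite (face0_join sJ ms ts) -addrA -big_split big1 ?addr0 // => i _ /=.
rewrite (join_notin _ (faceS_join i sJ ms ts)) -raddfD /=.
by rewrite /bump add1n exprS mulN1r mulrNz addNr raddf0.
Qed.

(** In degree 0 the contraction ends at the vertex [a], with the augmentation as coefficient: the
    edge from m to another vertex s has boundary s - a. *)
Lemma bdry_join0 (c : C 0) (a : nsimplex K 0) : val a = [fset m]%fset ->
  supp_in (@spanned 0) c -> bdry (join c) + single a (augm c) = c.
Proof.
move=> am; move: c; apply: (@supp_in_additive_ext _ _ _ _
  ((@bdry (simplicial K) V 0 \o @join 0) \+
   (single a \o @augm (simplicial K) V)) idfun) => s g sJ /=.
rewrite augm_single.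
have s1 : #|` val (s : nsimplex K 0)| = 1%N := (nsimplexP s).2.
have [ms|ms] := boolP (m \in val (s : nsimplex K 0)).
  rewrite join_in // raddf0 add0r; congr (single _ _); apply: val_inj; rewrite am.
  apply/eqP; rewrite eqEfcard fsub1set ms cardfs1.
  by move: s1 => /= ->.
have [t ts tJ] := joinable sJ ms.
rewrite (join_notin _ ts) bdry_single !big_ord_recl big_ord0 expr0 mulr1z /= addr0.
rewrite (face0_join sJ ms ts) -addrA.
suff -> : simplicial_face (lift ord0 ord0) t = a.
  by rewrite -raddfD /= expr1 mulrNz addNr raddf0 addr0.
apply/val_inj/fsetP => x; rewrite val_face in_del_vertex ts vertices_join //.
have : size (vertices (val (s : nsimplex K 0))) = 1%N by rewrite size_vertices.
by case: (vertices _) => [|y []] //= _; rewrite am !inE.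
Qed.

Lemma full_simplex_exact p (c : C p.+1) : supp_in (@spanned p.+1) c ->
  bdry c = 0 -> exists2 b, supp_in (@spanned p.+2) b & bdry b = c.
Proof.
move=> cJ c0; exists (join c); first exact: join_spanned.
by rewrite -[RHS](bdry_join cJ) c0 raddf0 addr0.
Qed.

Lemma full_simplex_exact0 (c : C 0) : supp_in (@spanned 0) c ->
  augm c = 0 -> exists2 b, supp_in (@spanned 1) b & bdry b = c.
Proof.
move=> cJ c0; exists (join c); first exact: join_spanned.
have [a am _] := apex_simplex.
by rewrite -[RHS](bdry_join0 am cJ) c0 raddf0 addr0.
Qed.

End FullSimplex.

(** * The double complex of the cover *)

Section Coordinates.
Variables (T T' : choiceType) (G : zmodType).

Definition ev (s : T') (c : fchain T' G) : G := coeff c s.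

Lemma ev_is_zmod_morphism s : zmod_morphism (ev s).
Proof. by []. Qed.

HB.instance Definition _ s :=
  GRing.isZmodMorphism.Build (fchain T' G) G (ev s) (ev_is_zmod_morphism s).

(** Splits [w] by the simplices of its coefficients instead of those of the chain itself, so that
    row exactness can be checked one singular simplex at a time. *)
Lemma sum_coef_ev (w : fchain T (fchain T' G)) :
  exists r : seq T', w = \sum_(s <- r) coef (single s) (coef (ev s) w).
Proof.
pose A := \bigcup_(t in [set t | coeff w t != 0])
  [set s | coeff (coeff w t) s != 0].
have Afin : finite_set A.
  by apply: bigcup_finite => [|t _]; exact: coeff_finite.
exists (fset_set A); apply: fchain_eq => t; rewrite coeff_sum.
rewrite [LHS](@fchain_sum_seq _ _ (fset_set A)) ?fset_uniq //.
move=> s ws; rewrite in_fset_set // inE; exists t => //=.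
by apply: contra_neq ws => ->; rewrite coeff0.
Qed.

End Coordinates.

Lemma sum_preimage (A B : zmodType) (f : {additive A -> B}) (Q : A -> Prop)
    (T : eqType) (r : seq T) (F : T -> B) :
  Q 0 -> (forall a b, Q a -> Q b -> Q (a + b)) ->
  (forall t, t \in r -> exists2 a, Q a & f a = F t) ->
  exists2 a, Q a & f a = \sum_(t <- r) F t.
Proof.
move=> Q0 QD; elim: r => [|t r IH] QF; first by exists 0; rewrite ?big_nil ?raddf0.
have [a Qa fa] := QF t (mem_head _ _).
have [|b Qb fb] := IH; first by move=> u ur; apply: QF; rewrite inE ur orbT.
by exists (a + b); [exact: QD|rewrite big_cons raddfD fa fb].
Qed.

(** * Singular chains of a subspace as carried chains of X *)

Section Subspace.
Variables (R : realType) (G : zmodType) (X : topologicalType) (A : set X).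
Local Notation Delta n := (set_type (@stdsimplex R n)).
Local Notation S n := (fchain (simplex (singular R X) n) G).
Local Notation SA n := (fchain (simplex (singular R (set_type A)) n) G).

Definition incl_fun n (s : continuousType (Delta n) (set_type A)) (x : Delta n) :
  X := set_val (s x).

Lemma continuous_incl_fun n s : continuous (@incl_fun n s).
Proof.
move=> x; apply: (@continuous_comp _ _ _ s set_val); first exact: cts_fun.
exact: initial_continuous.
Qed.

HB.instance Definition _ n s :=
  isContinuous.Build _ _ (@incl_fun n s) (@continuous_incl_fun n s).

Definition incl_simplex n (s : simplex (singular R (set_type A)) n) :
  simplex (singular R X) n := (incl_fun s : continuousType _ _).

Section Lift.
Variables (n : nat) (s : continuousType (Delta n) X) (sA : forall x, A (s x)).

Definition lift_fun (x : Delta n) : set_type A :=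
  exist (fun y => y \in A) (s x) (mem_set (sA x)).

Lemma continuous_lift_fun : continuous lift_fun.
Proof.
by apply: continuous_comp_initial => /= x; exact: (@cts_fun _ _ s).
Qed.

HB.instance Definition _ :=
  isContinuous.Build _ _ lift_fun continuous_lift_fun.

Definition lift_simplex : simplex (singular R (set_type A)) n :=
  (lift_fun : continuousType _ _).
End Lift.

Definition incl n : SA n -> S n := lin (fun s => single (incl_simplex s)).

HB.instance Definition _ n := GRing.isZmodMorphism.Build (SA n) (S n) (@incl n)
  (@lin_is_zmod_morphism _ _ _ (fun s => single (incl_simplex s))).

Definition restr_fun n (s : continuousType (Delta n) X) : {additive G -> SA n} :=
  if pselect (forall x, A (s x)) is left sA then single (lift_simplex sA) else \0.

Definition restr n : S n -> SA n := lin (@restr_fun n).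

HB.instance Definition _ n := GRing.isZmodMorphism.Build (S n) (SA n) (@restr n)
  (@lin_is_zmod_morphism _ _ _ (@restr_fun n)).

Lemma incl_single n s g : incl (single s g) = single (@incl_simplex n s) g.
Proof. by rewrite /incl lin_single. Qed.

Lemma carried_incl n (c : SA n) : supp_in (@carried R X A n) (incl c).
Proof.
have := @supp_inT _ _ c; move: c; apply: supp_in_additive => s g _.
rewrite /= incl_single; apply: supp_in_single => x.
by rewrite /= /incl_fun; exact: set_valP.
Qed.

Lemma restr_incl n (c : SA n) : restr (incl c) = c.
Proof.
move: c; apply: (@additive_ext _ _ _ (@restr n \o @incl n) idfun) => s g /=.
rewrite incl_single /restr lin_single /restr_fun; case: pselect => [sA|nsA].
  congr (single _ _); apply/continuousEP => x; apply: val_inj.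
  by rewrite /lift_simplex.
by case: nsA => x; exact: set_valP.
Qed.

Lemma incl_restr n (c : S n) : supp_in (@carried R X A n) c -> incl (restr c) = c.
Proof.
move: c; apply: (@supp_in_additive_ext _ _ _ _ (@incl n \o @restr n) idfun).
move=> s g sA /=; rewrite /restr lin_single /restr_fun.
case: pselect => // sA'; rewrite incl_single; congr (single _ _).
exact/continuousEP.
Qed.

Lemma bdry_incl n (c : SA n.+1) : bdry (incl c) = incl (bdry c).
Proof.
move: c; apply: (@additive_ext _ _ _ (@bdry (singular R X) G n \o @incl n.+1)
  (@incl n \o @bdry (singular R (set_type A)) G n)) => s g /=.
rewrite incl_single !bdry_single (raddf_sum (@incl n)) /=.
apply: eq_bigr => i _; rewrite incl_single; congr (single _ _).
exact/continuousEP.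
Qed.

Lemma augm_incl (c : SA 0) : augm (incl c) = augm c.
Proof.
move: c; apply: (@additive_ext _ _ _ (@augm (singular R X) G \o @incl 0)
  (@augm (singular R (set_type A)) G)) => s g /=.
by rewrite incl_single !augm_single.
Qed.

(** [restr] sends simplices leaving A to 0 and need not commute with [bdry]. The cycle condition is
    therefore checked after applying [incl], which does commute and is injective. *)
Lemma rcycles_restr n (c : S n) : supp_in (@carried R X A n) c ->
  c \in @rcycles _ G n -> restr c \in @rcycles (singular R (set_type A)) G n.
Proof.
case: n c => [|n] c cA; rewrite !unfold_in /= => /eqP c0.
  by rewrite -augm_incl incl_restr // c0.
apply/eqP; rewrite -[LHS]restr_incl -bdry_incl incl_restr //.
by rewrite (c0 : bdry c = 0) raddf0.
Qed.

End Subspace.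

Section Subquotients.
Variables (A : zmodType) (Z B : zmodClosed A).

Definition qpi (u : subZ Z) : subquotient Z B :=
  (\pi_(Quotient.quot (@subB A Z B)) u)%qT.

Lemma qpi_is_zmod_morphism : zmod_morphism qpi.
Proof. exact: (raddfB (\pi_(Quotient.quot (@subB A Z B)))%qT). Qed.

HB.instance Definition _ :=
  GRing.isZmodMorphism.Build (subZ Z) (subquotient Z B) qpi qpi_is_zmod_morphism.

Lemma qpi_eq0 u : qpi u = 0 <-> val u \in B.
Proof.
rewrite -(raddf0 qpi); split=> [/eqP|uB]; last apply/eqP.
  by rewrite -Quotient.idealrBE subr0.
by rewrite -Quotient.idealrBE subr0.
Qed.

Lemma qpi_surj x : exists u, qpi u = x.
Proof. by exists (repr x); exact: reprK. Qed.
End Subquotients.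
Lemma subquotient_eq0 (A : zmodType) (Z B : zmodClosed A) :
  (forall x : subquotient Z B, x = 0) -> forall a, a \in Z -> a \in B.
Proof.
move=> q0 a aZ.
exact/(qpi_eq0 B (exist (fun x => x \in Z) a aZ : subZ Z))/q0.
Qed.

(** * Exactness of the rows and columns *)

Section NerveDoubleComplex.
Variables (R : realType) (G : zmodType) (X : topologicalType).
Variables (I : choiceType) (U : I -> set X).
Local Notation Delta n := (set_type (@stdsimplex R n)).
Local Notation S n := (fchain (simplex (singular R X) n) G).
Local Notation K := (nerve U).
Local Notation C p V := (fchain (simplex (simplicial K) p) V).

(** The direct sum over p-simplices s of the chains of the intersection at s, cut out by a predicate
    so that both differentials are the ambient [bdry] and [coef] of [bdry]. *)
Definition dcomplex p q (w : C p (S q)) : Prop := forall s : nsimplex K p,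
  supp_in (@carried R X (cover_meet U (val s)) q) (coeff w s).
Arguments dcomplex : clear implicits.

Lemma dcomplex0 p q : dcomplex p q 0.
Proof. by move=> s; exact: supp_in0. Qed.

Lemma dcomplexD p q w w' :
  dcomplex p q w -> dcomplex p q w' -> dcomplex p q (w + w').
Proof.
by move=> wD w'D s; rewrite coeffD; apply: supp_inD; [exact: wD|exact: w'D].
Qed.

Lemma dcomplexB p q w w' :
  dcomplex p q w -> dcomplex p q w' -> dcomplex p q (w - w').
Proof.
by move=> wD w'D s; rewrite coeffB; apply: supp_inB; [exact: wD|exact: w'D].
Qed.

Lemma dcomplex_sum p q (T : Type) (r : seq T) F :
  (forall i, dcomplex p q (F i)) -> dcomplex p q (\sum_(i <- r) F i).
Proof.
move=> FD; elim: r => [|i r IH]; first by rewrite big_nil; exact: dcomplex0.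
by rewrite big_cons; exact: dcomplexD.
Qed.

Lemma dcomplex_single p q (s : nsimplex K p) c :
  supp_in (@carried R X (cover_meet U (val s)) q) c -> dcomplex p q (single s c).
Proof.
move=> cs t; rewrite coeff_single; case: eqP => [-> //|_]; exact: supp_in0.
Qed.

Lemma carried_face (A : set X) n (s : simplex (singular R X) n.+1) i :
  carried A s -> carried A (face i s).
Proof. by move=> sA x; exact: sA. Qed.

Lemma carried_bdry (A : set X) n (c : S n.+1) :
  supp_in (@carried R X A n.+1) c -> supp_in (@carried R X A n) (bdry c).
Proof.
move: c; apply: supp_in_additive => s g sA.
rewrite /= bdry_single; apply: supp_in_sum => i _.
by apply: supp_in_single; exact: carried_face.
Qed.

Lemma dcomplex_coef_bdry p q w :
  dcomplex p q.+1 w -> dcomplex p q (coef (@bdry _ _ q) w).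
Proof. by move=> wD s; rewrite coeff_coef; apply: carried_bdry; exact: wD. Qed.

Lemma cover_meet_face p (i : 'I_p.+2) (s : nsimplex K p.+1) :
  cover_meet U (val s) `<=` cover_meet U (val (simplicial_face i s)).
Proof.
move=> x sx j /=; rewrite in_del_vertex => /(mem_subseq (del_subseq _ _)).
by rewrite fset_vertices => /sx.
Qed.

Lemma dcomplex_bdry p q w : dcomplex p.+1 q w -> dcomplex p q (bdry w).
Proof.
move=> wD; rewrite (fchain_sum_single w) raddf_sum.
apply: dcomplex_sum => s /=; rewrite bdry_single; apply: dcomplex_sum => i.
apply: dcomplex_single; apply: supp_in_Mz.
by apply: sub_supp_in (wD s) => t ts x; apply: cover_meet_face; exact: ts.
Qed.

Lemma carried_small (s : {fset I}) q (t : simplex (singular R X) q) :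
  s != fset0 -> carried (cover_meet U s) t -> small U t.
Proof. by move=> /fset0Pn[i si] ts; exists i => x; exact: ts. Qed.

Lemma small_augm q w : dcomplex 0 q w -> supp_in (@small R X I U q) (augm w).
Proof.
move=> wD; rewrite (fchain_sum_single w) raddf_sum; apply: supp_in_sum => s _ /=.
rewrite augm_single; apply: sub_supp_in (wD s) => t.
by apply: carried_small; exact: simplices_neq0 (nsimplexP s).1.
Qed.

Section Row.
Variables (q : nat) (s : simplex (singular R X) q).
Let J : set I := [set i | carried (U i) s].

(** Sets [U i] that all carry [s] have a common point: any value of [s], here at a vertex of the
    standard simplex. *)
Lemma row_simplex (t : {fset I}) : t != fset0 -> (forall i, i \in t -> J i) -> K t.
Proof.
move=> t0 tJ; split=> //.
by exists ((s : continuousType _ _) (vertex R ord0)) => i /= it; exact: tJ.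
Qed.

Lemma minimal_index i : J i -> exists2 m, J m & forall x, J x -> vle m x.
Proof.
move=> Ji; have [|m [[mJ m_min] _]] :=
    svalP (well_ordering_principle I) [pred x | `[< J x >]].
  by exists i; exact/asboolP.
exists m; first exact/asboolP.
by move=> x Jx; apply: m_min; exact/asboolP.
Qed.

Lemma dcomplex_coef_single p (b : C p G) :
  supp_in (@spanned I K J p) b -> dcomplex p q (coef (single s) b).
Proof.
move=> bJ t; rewrite coeff_coef => u; rewrite coeff_single.
case: ifP => [/eqP -> bt x i /= it|_ /eqP //]; exact: (bJ _ bt).
Qed.

Lemma spanned_coef_ev p (w : C p (S q)) :
  dcomplex p q w -> supp_in (@spanned I K J p) (coef (ev s) w).
Proof.
by move=> wD t; rewrite coeff_coef => /(wD t) ts i it x; exact: ts.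
Qed.

Lemma spanned_nonempty p (c : C p G) :
  supp_in (@spanned I K J p) c -> c != 0 -> exists i, J i.
Proof.
move=> cJ /fchain_neq0[t /cJ tJ].
have /fset0Pn[i it] := simplices_neq0 (nsimplexP t).1.
by exists i; exact: tJ.
Qed.

End Row.

Lemma row_exact p q w : dcomplex p.+1 q w -> bdry w = 0 ->
  exists2 b, dcomplex p.+2 q b & bdry b = w.
Proof.
move=> wD w0; have [r ->] := sum_coef_ev w.
apply: (sum_preimage (f := @bdry (simplicial K) (S q) p.+1)).
- exact: dcomplex0.
- by move=> a b; exact: dcomplexD.
move=> s _; have wJ := spanned_coef_ev (s := s) wD; set c := coef _ w in wJ *.
(* [c] is a cycle on the full simplex spanned by the i such that [U i] carries [s]. When [c] is
   nonzero this index set is inhabited, hence has a least vertex to cone onto. *)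
have [->|c0] := eqVneq c 0.
  by exists 0; [exact: dcomplex0|rewrite !raddf0].
have [i /minimal_index[m mJ m_min]] := spanned_nonempty wJ c0.
have [|b bJ bc] := full_simplex_exact mJ m_min (@row_simplex _ s) wJ.
  by rewrite /c -coef_bdry w0 raddf0.
exists (coef (single s) b); first exact: dcomplex_coef_single.
by rewrite -bc coef_bdry.
Qed.

Lemma row_exact0 q w : dcomplex 0 q w -> augm w = 0 ->
  exists2 b, dcomplex 1 q b & bdry b = w.
Proof.
move=> wD w0; have [r ->] := sum_coef_ev w.
apply: (sum_preimage (f := @bdry (simplicial K) (S q) 0)).
- exact: dcomplex0.
- by move=> a b; exact: dcomplexD.
move=> s _; have wJ := spanned_coef_ev (s := s) wD; set c := coef _ w in wJ *.
have [->|c0] := eqVneq c 0.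
  by exists 0; [exact: dcomplex0|rewrite !raddf0].
have [i /minimal_index[m mJ m_min]] := spanned_nonempty wJ c0.
have [|b bJ bc] := full_simplex_exact0 mJ m_min (@row_simplex _ s) wJ.
  by rewrite /c augm_coef w0 raddf0.
exists (coef (single s) b); first exact: dcomplex_coef_single.
by rewrite -bc coef_bdry.
Qed.

Lemma row_surj q (c : S q) : supp_in (@small R X I U q) c ->
  exists2 w, dcomplex 0 q w & augm w = c.
Proof.
move: c; apply: supp_in_ind.
- by exists 0; [exact: dcomplex0|rewrite raddf0].
- move=> c d [w wD <-] [v vD <-].
  by exists (w + v); [exact: dcomplexD|rewrite raddfD].
move=> s g [i si].
have [x J1 [a am aJ]] : exists2 x, carried (U x) s &
    exists2 a : nsimplex K 0, val a = [fset x]%fset &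
      spanned [set i | carried (U i) s] a.
  have [x xJ x_min] := minimal_index si; exists x => //.
  exact: (apex_simplex xJ (@row_simplex _ s)).
exists (single a (single s g)); last by rewrite augm_single.
by apply: dcomplex_single; apply: supp_in_single => y j ja; exact: aJ.
Qed.

(** Intersections indexed by simplices of the nerve are nonempty, so a constant 0-simplex has the
    required augmentation. This works for every [p], in particular for p = k + 1. *)
Lemma column_surj p (c : C p G) :
  exists2 w, dcomplex p 0 w & coef (@augm (singular R X) G) w = c.
Proof.
have := @supp_inT _ _ c; move: c; apply: supp_in_ind.
- by exists 0; [exact: dcomplex0|rewrite raddf0].
- move=> c d [w wD <-] [v vD <-].
  by exists (w + v); [exact: dcomplexD|rewrite raddfD].
move=> s g _; have [[_ [x sx]] _] := nsimplexP s.
exists (single s (single (cst x : continuousType (Delta 0) X) g)).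
  by apply: dcomplex_single; apply: supp_in_single => y.
by rewrite coef_single /= augm_single.
Qed.

Variable k : nat.
Hypothesis acyclic : forall s : {fset I}, skeleton k K s ->
  forall j : nat, (j <= k - sdim s)%N ->
  forall x : reduced_singular_homology R G (set_type (cover_meet U s)) j, x = 0.

(** [p + q <= k] puts [val s] in the k-skeleton and [q] in the acyclic range. The chain is moved
    into the subspace by [restr], bounded there and brought back by [incl]. *)
Lemma column_fill p q (s : nsimplex K p) (c : S q) : (p + q <= k)%N ->
  supp_in (@carried R X (cover_meet U (val s)) q) c -> c \in @rcycles _ G q ->
  exists2 b, supp_in (@carried R X (cover_meet U (val s)) q.+1) b & bdry b = c.
Proof.
move=> pqk cs cZ; have [Ks sp] := nsimplexP s.
have sdimE : sdim (val s) = p by rewrite /sdim sp.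
have sk : skeleton k K (val s).
  by split=> //; rewrite sdimE (leq_trans (leq_addr q p)).
have qk : (q <= k - sdim (val s))%N by rewrite sdimE; lia.
have := subquotient_eq0 (acyclic sk qk) (rcycles_restr cs cZ).
rewrite unfold_in => /asboolP[b bE].
exists (incl b); first exact: carried_incl.
by rewrite bdry_incl bE incl_restr.
Qed.

(** [rcycles] is the kernel of [augm] for q = 0 and of [bdry] otherwise, which treats both ends of
    the augmented column at once, one coefficient at a time. *)
Lemma column_exact_rcycles p q w : (p + q <= k)%N -> dcomplex p q w ->
  (forall s, coeff w s \in @rcycles _ G q) ->
  exists2 b, dcomplex p q.+1 b & coef (@bdry _ _ q) b = w.
Proof.
move=> pqk wD wZ; rewrite (fchain_sum_single w).
apply: (sum_preimage (f := coef (@bdry (singular R X) G q))).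
- exact: dcomplex0.
- by move=> a b; exact: dcomplexD.
move=> s _; have [b bs bE] := column_fill pqk (wD s) (wZ s).
exists (single s b); first exact: dcomplex_single.
by rewrite /= coef_single /= bE.
Qed.

Lemma column_exact p q w : (p + q.+1 <= k)%N -> dcomplex p q.+1 w ->
  coef (@bdry _ _ q) w = 0 ->
  exists2 b, dcomplex p q.+2 b & coef (@bdry _ _ q.+1) b = w.
Proof.
move=> pqk wD w0; apply: column_exact_rcycles => // s; rewrite unfold_in /=.
by rewrite -[bdry _](coeff_coef (@bdry (singular R X) G q)) w0.
Qed.

Lemma column_exact0 p w : (p <= k)%N -> dcomplex p 0 w ->
  coef (@augm (singular R X) G) w = 0 ->
  exists2 b, dcomplex p 1 b & coef (@bdry _ _ 0) b = w.
Proof.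
move=> pk wD w0; apply: column_exact_rcycles => //; first by rewrite addn0.
move=> s; rewrite unfold_in /=.
by rewrite -[augm _](coeff_coef (@augm (singular R X) G)) w0.
Qed.

End NerveDoubleComplex.

(** * Staircases in a double complex *)

(** Staircases are total families in which only one total degree matters; this starts such a family
    from a single prescribed entry. *)
Lemma family_at (V : nat -> zmodType) n (v : V n) :
  exists f : forall q, V q, f n = v.
Proof.
exists (fun q => if pselect (n = q) is left e then eq_rect n V v q e else 0).
by case: pselect => // e; rewrite (eq_irrelevance e erefl).
Qed.

Section Staircase.
Variables (E : nat -> nat -> zmodType) (A : nat -> zmodType).
Variables (dh : forall p q, {additive E p.+1 q -> E p q})
  (eh : forall q, {additive E 0 q -> A q}).
Variable D : forall p q, E p q -> Prop.
Hypothesis DB : forall p q (x y : E p q), D x -> D y -> D (x - y).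

Variable k : nat.
Hypothesis row_ex : forall p q (x : E p.+1 q), (p.+1 + q <= k)%N -> D x ->
  dh p q x = 0 -> exists2 y, D y & dh p.+1 q y = x.
Hypothesis row_ex0 : forall q (x : E 0 q), (q <= k)%N -> D x ->
  eh q x = 0 -> exists2 y, D y & dh 0 q y = x.

(* Used with dv and, to solve dh u = dv u, with - dv and w = 0. *)
Section Fill.
Variables (dv : forall p q, E p q.+1 -> E p q) (dA : forall q, A q.+1 -> A q).
Hypothesis dvB : forall p q, zmod_morphism (@dv p q).
Hypothesis dvD : forall p q (x : E p q.+1), D x -> D (dv x).
Hypothesis dvv : forall p q (x : E p q.+2), dv (dv x) = 0.
Hypothesis dhv : forall p q (x : E p.+1 q.+1), dh p q (dv x) = dv (dh p q.+1 x).
Hypothesis ehv : forall q (x : E 0 q.+1), eh q (dv x) = dA (eh q.+1 x).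

Variables (n : nat) (w : forall p q, E p q) (b : E 0 n.+1).
Hypothesis nk : (n <= k)%N.
Hypothesis wD : forall p q, (p + q)%N = n -> D (w p q).
Hypothesis wZ : forall p q, (p + q).+1 = n -> dh p q (w p.+1 q) = dv (w p q.+1).
Hypothesis bD : D b.
Hypothesis wb : eh n (w 0%N n) = dA (eh n.+1 b).

(** The equations are solved for increasing [p], starting from [b]. Each right-hand side w - dv u
    lies in the kernel of dh: both dh w and dh(dv u) = dv(dh u) equal dv of the previous w, since dv
    dv = 0. For p = 0 the hypothesis [wb] plays this part. *)
Lemma fill : exists u : forall p q, E p q,
  [/\ u 0%N n.+1 = b, forall p q, (p + q)%N = n.+1 -> D (u p q) &
      forall p q, (p + q)%N = n -> dh p q (u p.+1 q) = w p q - dv (u p q.+1)].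
Proof.
have [u0 u0b] := family_at b.
(* A solution is chosen in every column, with default 0; only on the diagonal [p + q = n] is it
   shown below that one exists. *)
pose fix u p : forall q, E p q :=
  match p return forall q, E p q with
  | 0 => u0
  | p'.+1 => fun q => xget 0
      [set x | D x /\ dh p' q x = w p' q - dv (u p' q.+1)]
  end.
suff uP p q : (p + q)%N = n ->
    D (u p.+1 q) /\ dh p q (u p.+1 q) = w p q - dv (u p q.+1).
  exists u; split=> // [[|p] q pq|p q /uP[] //].
    by move: pq; rewrite add0n => ->; rewrite /= u0b.
  by have [] := uP p q _; first by case: pq.
have step p' q' : (exists2 x, D x & dh p' q' x = w p' q' - dv (u p' q'.+1)) ->
    D (u p'.+1 q') /\ dh p' q' (u p'.+1 q') = w p' q' - dv (u p' q'.+1).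
  move=> [x xD xE].
  exact: (@xgetPex _ 0 [set x | D x /\ dh p' q' x = w p' q' - dv (u p' q'.+1)]
    (ex_intro _ x (conj xD xE))).
elim: p q => [|p IH] q pq; apply: step.
  move: pq; rewrite add0n => ->; apply: row_ex0 => //.
    by apply: DB; [exact: wD|apply: dvD; rewrite /= u0b].
  by rewrite raddfB /= ehv u0b wb subrr.
have [uD uE] := IH q.+1 (etrans (addnS p q) pq).
apply: row_ex; first by rewrite pq.
  by apply: DB; [exact: wD|exact: dvD].
by rewrite raddfB /= wZ // dhv uE dvB dvv subr0 subrr.
Qed.

End Fill.

Variables (dv : forall p q, {additive E p q.+1 -> E p q})
  (dA : forall q, {additive A q.+1 -> A q}).
Hypothesis dvD : forall p q (x : E p q.+1), D x -> D (dv p q x).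
Hypothesis dvv : forall p q (x : E p q.+2), dv p q (dv p q.+1 x) = 0.
Hypothesis dhv : forall p q (x : E p.+1 q.+1),
  dh p q (dv p.+1 q x) = dv p q (dh p q.+1 x).
Hypothesis ehv : forall q (x : E 0 q.+1), eh q (dv 0 q x) = dA q (eh q.+1 x).

Hypothesis D0 : forall p q, D (0 : E p q).

(* Cycles of degree n of the total complex, up to a change of signs: with the
   commuting differentials dh and dv, cycles are given by dh w = dv w, and
   boundaries have the form dh u + dv u. *)
Definition zigzag n (w : forall p q, E p q) :=
  (forall p q, (p + q)%N = n -> D (w p q)) /\
  (forall p q, (p + q).+1 = n -> dh p q (w p.+1 q) = dv p q (w p q.+1)).

Lemma zigzag_lift0 (b : E 0 0) : D b -> exists2 w, zigzag 0 w & w 0%N 0%N = b.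
Proof.
move=> bD; have [f fb] := family_at b.
exists (fun p => if p is 0 return forall q, E p q then f else fun=> 0) => //.
by split=> // [[|p] [|q]] //= _; rewrite fb.
Qed.

(** Only equations of total degree [n] are solved, so exactness up to [n] already yields a staircase
    of degree [n.+1]. *)
Lemma zigzag_lift n (b : E 0 n.+1) : (n <= k)%N -> D b ->
  dA n (eh n.+1 b) = 0 -> exists2 w, zigzag n.+1 w & w 0%N n.+1 = b.
Proof.
move=> nk bD b0.
have [|||||||||u [ub uD uE]] := @fill (fun p q x => - dv p q x)
    (fun q x => - dA q x) _ _ _ _ _ n (fun p q => 0) b nk.
- by move=> p q x y; rewrite raddfB opprB opprK addrC.
- by move=> p q x xD; rewrite -sub0r; apply: DB; [exact: D0|exact: dvD].
- by move=> p q x; rewrite (raddfN (dv p q)) opprK dvv.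
- by move=> p q x; rewrite (raddfN (dh p q)) dhv.
- by move=> q x; rewrite (raddfN (eh q)) ehv.
- by [].
- by move=> p q _; rewrite (raddf0 (dh p q)) (raddf0 (dv p q)) oppr0.
- by [].
- by rewrite (raddf0 (eh n)) b0 oppr0.
exists u => //; split=> // p q [pq].
by rewrite uE // sub0r opprK.
Qed.

Variables (C : nat -> zmodType) (ev : forall p, {additive E p 0 -> C p}).
Variable dC : forall p, {additive C p.+1 -> C p}.
Hypothesis evv : forall p (x : E p 1), ev p (dv p 0 x) = 0.
Hypothesis evh : forall p (x : E p.+1 0), ev p (dh p 0 x) = dC p (ev p.+1 x).

(** Filling writes w as dh u + dv u. At the far corner (n, 0) the augmentation [ev] kills dv u and
    turns dh u into a boundary. *)
Lemma zigzag_boundary n w (b : E 0 n.+1) : (n <= k)%N -> zigzag n w -> D b ->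
  eh n (w 0%N n) = dA n (eh n.+1 b) ->
  exists2 x, D x & ev n (w n 0%N) = dC n (ev n.+1 x).
Proof.
move=> nk [wD wZ] bD wb.
have [|||||u [ub uD uE]] := @fill (fun p q => dv p q) (fun q => dA q) _ _ _ _ _
  n w b nk wD wZ bD wb => //.
  by move=> p q x y; rewrite raddfB.
exists (u n.+1 0%N); first by apply: uD; rewrite addn0.
by rewrite -evh uE ?addn0 // raddfB evv subr0.
Qed.

Lemma zigzagB n w w' : zigzag n w -> zigzag n w' ->
  zigzag n (fun p q => w p q - w' p q).
Proof.
move=> [wD wZ] [wD' wZ']; split=> p q pq.
  by apply: DB; [exact: wD|exact: wD'].
by rewrite !raddfB wZ // wZ'.
Qed.

Lemma zigzag_cycle n w : zigzag n.+1 w -> dC n (ev n.+1 (w n.+1 0%N)) = 0.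
Proof. by move=> [_ wZ]; rewrite -evh wZ ?addn0 // evv. Qed.

End Staircase.

(** Staircases are symmetric in the two directions, so the lemmas above serve for the rows and, with
    the indices exchanged, for the columns. *)
Lemma zigzag_tr (E : nat -> nat -> zmodType)
    (dh : forall p q, {additive E p.+1 q -> E p q}) (D : forall p q, E p q -> Prop)
    (dv : forall p q, {additive E p q.+1 -> E p q}) n w :
  zigzag dh D dv n w ->
  zigzag (E := fun p q => E q p) (fun p q => dv q p) (fun p q => @D q p)
    (fun p q => dh q p) n (fun p q => w q p).
Proof.
by move=> [wD wZ]; split=> p q; rewrite addnC => pq; [exact: wD|rewrite wZ].
Qed.

(** * Comparison of the two homologies *)

Section RelationIsomorphism.
Variables (A A' : zmodType) (Z B : zmodClosed A) (Z' B' : zmodClosed A').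
Variable r : A -> A' -> Prop.
Hypothesis rB : forall x x' y y', r x y -> r x' y' -> r (x - x') (y - y').
Hypothesis rZ : forall x y, r x y -> x \in Z /\ y \in Z'.
Hypothesis r_total : forall x, x \in Z -> exists y, r x y.
Hypothesis r_onto : forall y, y \in Z' -> exists x, r x y.
Hypothesis r_boundary : forall x y, r x y -> (x \in B <-> y \in B').

(** The relation descends to the quotients. Closed under differences and matching B with B', it
    relates 0 only to 0, hence is single-valued in both directions; choosing images and preimages
    gives an additive map and its inverse. *)
Lemma subquotient_isomorphic :
  zmod_isomorphic (subquotient Z B) (subquotient Z' B').
Proof.
pose F (xi : subquotient Z B) (eta : subquotient Z' B') :=
  exists u v, [/\ qpi B u = xi, qpi B' v = eta & r (val u) (val v)].
have FB xi xi' eta eta' : F xi eta -> F xi' eta' -> F (xi - xi') (eta - eta').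
  move=> [u [v [<- <- uv]]] [u' [v' [<- <- uv']]]; exists (u - u'), (v - v').
  by split; [exact: raddfB|exact: raddfB|rewrite !raddfB; exact: rB].
have F0 xi eta : F xi eta -> (xi = 0 <-> eta = 0).
  move=> [u [v [<- <- uv]]]; apply: iff_trans (qpi_eq0 B u) _.
  by apply: iff_trans (r_boundary uv) _; apply: iff_sym; exact: qpi_eq0.
have F_total xi : exists eta, F xi eta.
  have [u uE] := qpi_surj xi; have [y uy] := r_total (valP u).
  exists (qpi B' (exist (fun y => y \in Z') y (rZ uy).2 : subZ Z')).
  by exists u, (exist (fun y => y \in Z') y (rZ uy).2).
have F_onto eta : exists xi, F xi eta.
  have [v vE] := qpi_surj eta; have [x xv] := r_onto (valP v).
  exists (qpi B (exist (fun x => x \in Z) x (rZ xv).1 : subZ Z)).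
  by exists (exist (fun x => x \in Z) x (rZ xv).1), v.
have F_fun xi eta eta' : F xi eta -> F xi eta' -> eta = eta'.
  move=> Fe Fe'; apply/eqP; rewrite -subr_eq0; apply/eqP.
  by apply/(F0 _ _ (FB _ _ _ _ Fe Fe')); rewrite subrr.
have [f fF] := choice F_total; have [g gF] := choice F_onto.
have f_add : zmod_morphism f.
  by move=> xi xi'; apply: F_fun (fF _) _; exact: FB.
pose fm := GRing.isZmodMorphism.Build _ _ f f_add.
exists (HB.pack f fm : {additive _ -> _}); exists g => /= [xi|eta]; last first.
  exact: F_fun (fF _) (gF _).
apply/eqP; rewrite -subr_eq0; apply/eqP.
by apply/(F0 _ _ (FB _ _ _ _ (gF _) (fF xi))); rewrite subrr.
Qed.

End RelationIsomorphism.

Section NerveComparison.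
Variables (R : realType) (G : zmodType) (X : topologicalType).
Variables (I : choiceType) (U : I -> set X) (k : nat).
Hypotheses (Uopen : forall i, open (U i)) (Ucover : \bigcup_i U i = [set: X]).
Local Notation K := (nerve U).
Local Notation S n := (fchain (simplex (singular R X) n) G).
Local Notation C n := (fchain (simplex (simplicial K) n) G).
Hypothesis acyclic : forall s : {fset I}, skeleton k K s ->
  forall j : nat, (j <= k - sdim s)%N ->
  forall x : reduced_singular_homology R G (set_type (cover_meet U s)) j, x = 0.

Let E p q : zmodType := fchain (simplex (simplicial K) p) (S q).
Let D p q : E p q -> Prop := @dcomplex R G X I U p q.
Let dh p q : {additive E p.+1 q -> E p q} := @bdry (simplicial K) (S q) p.
Let dv p q : {additive E p q.+1 -> E p q} := coef (@bdry (singular R X) G q).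
Let eh q : {additive E 0 q -> S q} := @augm (simplicial K) (S q).
Let ev p : {additive E p 0 -> C p} := coef (@augm (singular R X) G).
Let dA q : {additive S q.+1 -> S q} := @bdry (singular R X) G q.
Let dC p : {additive C p.+1 -> C p} := @bdry (simplicial K) G p.

Let DB p q (x y : E p q) : D x -> D y -> D (x - y).
Proof. exact: dcomplexB. Qed.

Let D0 p q : D (0 : E p q).
Proof. exact: dcomplex0. Qed.

Let dhD p q (x : E p.+1 q) : D x -> D (dh p q x).
Proof. exact: dcomplex_bdry. Qed.

Let dvD p q (x : E p q.+1) : D x -> D (dv p q x).
Proof. exact: dcomplex_coef_bdry. Qed.

Let dhh p q (x : E p.+2 q) : dh p q (dh p.+1 q x) = 0.
Proof. exact: bdry_bdry. Qed.

Let ehh q (x : E 1 q) : eh q (dh 0 q x) = 0.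
Proof. exact: augm_bdry. Qed.

Let dvv p q (x : E p q.+2) : dv p q (dv p q.+1 x) = 0.
Proof. by apply: fchain_eq => s; exact: bdry_bdry. Qed.

Let evv p (x : E p 1) : ev p (dv p 0 x) = 0.
Proof. by apply: fchain_eq => s; exact: augm_bdry. Qed.

Let dhv p q (x : E p.+1 q.+1) : dh p q (dv p.+1 q x) = dv p q (dh p q.+1 x).
Proof. by apply/esym; exact: coef_bdry. Qed.

Let ehv q (x : E 0 q.+1) : eh q (dv 0 q x) = dA q (eh q.+1 x).
Proof. exact: augm_coef. Qed.

Let evh p (x : E p.+1 0) : ev p (dh p 0 x) = dC p (ev p.+1 x).
Proof. exact: coef_bdry. Qed.

(** The staircase ends exactly at [c] but reaches [a] only up to a boundary, because [a] may have to
    be replaced by a homologous small cycle before it lifts to the double complex. *)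
Definition nerve_rel n (a : S n) (c : C n) := a \in @cycles (singular R X) G n /\
  exists w, [/\ zigzag dh D dv n w, ev n (w n 0%N) = c &
                exists b, a - eh n (w 0%N n) = bdry b].

Lemma nerve_relB n a a' c c' : nerve_rel a c -> nerve_rel a' c' ->
  @nerve_rel n (a - a') (c - c').
Proof.
move=> [aZ [w [wZ <- [b bE]]]] [aZ' [w' [wZ' <- [b' bE']]]].
split; first exact: rpredB.
exists (fun p q => w p q - w' p q); split.
- exact: zigzagB.
- exact: raddfB.
- exists (b - b'); rewrite (raddfB (eh n)) (raddfB (@bdry _ _ n)) /= -bE -bE'.
  rewrite !opprB -!addrA; congr (_ + _); rewrite addrCA [RHS]addrCA.
  by congr (_ + _); exact: addrC.
Qed.

Lemma nerve_rel_cycles n a c : @nerve_rel n a c ->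
  a \in @cycles (singular R X) G n /\ c \in @cycles (simplicial K) G n.
Proof.
move=> [aZ [w [wZ <- _]]]; split=> //.
case: n {a aZ c} w wZ => // n w wZ; rewrite unfold_in /=; apply/eqP.
exact: (zigzag_cycle evv evh wZ).
Qed.

Lemma nerve_rel_total n a : a \in @cycles (singular R X) G n ->
  exists c, @nerve_rel n a c.
Proof.
move=> aZ; have [a' [b [a's a'Z aa']]] := homologous_small Uopen Ucover aZ.
have [x xD xE] := row_surj a's.
suff [w wZ wx] : exists2 w, zigzag dh D dv n w & w 0%N n = x.
  by exists (ev n (w n 0%N)); split=> //; exists w; split=> //; exists b;
    rewrite wx [eh n x]xE.
case: n {a aZ aa' b a's} a' a'Z x xD xE => [|n] a' a'Z x xD xE.
  exact: (zigzag_lift0 dh dv D0 xD).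
(* The rows are exact in all degrees, so the bound on exactness is taken to be [n] itself. *)
apply: (@zigzag_lift E (fun q => S q) dh eh D DB n _ _ dv dA dvD dvv dhv ehv D0
  n x (leqnn n) xD).
- by move=> p q y _; exact: row_exact.
- by move=> q y _; exact: row_exact0.
- by move: a'Z; rewrite unfold_in /= -xE => /eqP.
Qed.

(** The transposed construction: [c] is lifted by [column_surj] and the staircase climbs along the
    columns. The degree gained in [zigzag_lift] is what reaches k + 1. *)
Lemma nerve_rel_onto n c : (n <= k.+1)%N -> c \in @cycles (simplicial K) G n ->
  exists a, @nerve_rel n a c.
Proof.
move=> nk cZ; have [x xD xE] := column_surj R c.
suff [w wZ wx] : exists2 w, zigzag dh D dv n w & w n 0%N = x.
  exists (eh n (w 0%N n)); split; last first.
    by exists w; split=> //; [rewrite wx|exists 0; rewrite subrr raddf0].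
  case: n {nk c cZ x xD xE wx} w wZ => // n w wZ; rewrite unfold_in /=; apply/eqP.
  exact: (zigzag_cycle ehh ehv (zigzag_tr wZ)).
suff [w wZ wx] : exists2 w, zigzag (E := fun p q => E q p) (fun p q => dv q p)
    (fun p q => @D q p) (fun p q => dh q p) n w & w 0%N n = x.
  by exists (fun p q => w q p) => //; exact: (zigzag_tr wZ).
case: n nk c cZ x xD xE => [|n] nk c cZ x xD xE.
  exact: (@zigzag_lift0 (fun p q => E q p) _ (fun p q => @D q p) _
    (fun p q => @D0 q p) x xD).
apply: (@zigzag_lift (fun p q => E q p) (fun q => C q) (fun p q => dv q p) ev
  (fun p q => @D q p) (fun p q => @DB q p) k _ _ (fun p q => dh q p) dC
  (fun p q => @dhD q p) (fun p q => @dhh q p)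
  (fun p q x => esym (@dhv q p x)) evh (fun p q => @D0 q p)
  n x nk xD).
- by move=> p q y pqk; apply: (column_exact acyclic); rewrite addnC.
- by move=> q y qk; exact: (column_exact0 acyclic).
- by move: cZ; rewrite unfold_in /= -xE => /eqP.
Qed.

Lemma nerve_rel_boundary n a c : @nerve_rel n a c ->
  a \in @boundaries (singular R X) G n -> c \in @boundaries (simplicial K) G n.
Proof.
move=> [aZ [w [wZ <- [b bE]]]]; rewrite !unfold_in => /asboolP[b' b'E].
have wb : eh n (w 0%N n) = bdry (b' - b) by rewrite raddfB /= -bE b'E subKr.
have ws : supp_in (@small R X I U n) (eh n (w 0%N n)).
  by apply: small_augm; exact: wZ.1.
(* A bounding chain must itself be small in order to lift along [row_surj]. *)
have [b2 b2s b2E] := small_boundary Uopen Ucover ws wb.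
have [x xD xE] := row_surj b2s.
have [|||y _ yE] := @zigzag_boundary E (fun q => S q) dh eh D DB n _ _ dv dA dvD
  dvv dhv ehv (fun p => C p) ev dC evv evh n w x (leqnn n) wZ xD.
- by move=> p q y _; exact: row_exact.
- by move=> q y _; exact: row_exact0.
- by rewrite b2E -xE.
by apply/asboolP; exists (ev n.+1 y); rewrite yE.
Qed.

(** A chain bounded by [c] is lifted by [column_surj] and pushed along the transposed staircase; the
    columns must now be filled in total degree [n], whence [n <= k]. *)
Lemma nerve_rel_boundary_inv n a c : (n <= k)%N -> @nerve_rel n a c ->
  c \in @boundaries (simplicial K) G n -> a \in @boundaries (singular R X) G n.
Proof.
move=> nk [aZ [w [wZ <- [b bE]]]]; rewrite !unfold_in => /asboolP[c' c'E].
have [x xD xE] := column_surj R c'.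
have [|||y _ yE] := @zigzag_boundary (fun p q => E q p) (fun q => C q)
  (fun p q => dv q p) ev (fun p q => @D q p) (fun p q => @DB q p) k _ _
  (fun p q => dh q p) dC (fun p q => @dhD q p) (fun p q => @dhh q p)
  (fun p q x => esym (@dhv q p x)) evh
  (fun q => S q) eh dA ehh ehv n (fun p q => w q p) x nk (zigzag_tr wZ) xD.
- by move=> p q y pqk; apply: (column_exact acyclic); rewrite addnC.
- by move=> q y qk; exact: (column_exact0 acyclic).
- by rewrite -c'E -xE.
apply/asboolP; exists (eh n.+1 y + b); rewrite raddfD /= -bE.
by rewrite -[bdry _]yE addrC subrK.
Qed.

End NerveComparison.

Theorem theorem1 (R : realType) (G : zmodType) (X : topologicalType)
    (I : choiceType) (U : I -> set X) (k : nat)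
    (Uopen : forall i : I, open (U i))
    (Ucover : \bigcup_i U i = [set: X])
    (Uacyclic : forall s : {fset I}, skeleton k (nerve U) s ->
       forall j : nat, (j <= k - sdim s)%N ->
       forall x : reduced_singular_homology R G (set_type (cover_meet U s)) j,
         x = 0) :
  (forall j : nat, (j <= k)%N ->
     zmod_isomorphic (singular_homology R G X j)
                     (simplicial_homology G (nerve U) j)) /\
  ((exists x : simplicial_homology G (nerve U) k.+1, x != 0) ->
   (exists x : singular_homology R G X k.+1, x != 0)).
Proof.
split=> [j jk|[xi]].
  apply: (@subquotient_isomorphic _ _ _ _ _ _ (@nerve_rel R G X I U j)).
  - by move=> x x' y y'; exact: nerve_relB.
  - by move=> x y; exact: nerve_rel_cycles.
  - by move=> x; exact: nerve_rel_total.
  - by move=> y; apply: (nerve_rel_onto Uacyclic); exact: leqW.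
  - move=> x y xy; split; first exact: (nerve_rel_boundary Uopen Ucover xy).
    exact: (nerve_rel_boundary_inv Uacyclic jk xy).
(* A nonzero class of the nerve in degree k + 1 is related to a cycle [a] of X; if [a] were a
   boundary, [nerve_rel_boundary] would make the class vanish. *)
have [v <-] := qpi_surj xi => v0.
have [a av] := nerve_rel_onto Uacyclic (leqnn k.+1) (valP v).
have aZ := (nerve_rel_cycles av).1.
exists (qpi _ (exist (fun a => a \in @cycles (singular R X) G k.+1) a aZ
  : subZ (@cycles (singular R X) G k.+1))).
apply/eqP => /qpi_eq0 aB; move/eqP: v0; apply; apply/qpi_eq0.
exact: (nerve_rel_boundary Uopen Ucover av).
Qed.
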